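(* Let $n\ge 3$. An $n$-dimensional complex Jordan algebra is an algebra of level two if and only if it is isomorphic to one of the following $n$-dimensional commutative algebras, given by their multiplication tables in a basis: \begin{itemize} \item $J_1$, with basis $e, f_2,\dots,f_n$: $e\cdot e=e$ (that is, $J_1=\{e\}\oplus\mathfrak{a}_{n-1}$); \item $J_2$, with basis $e_1,\dots,e_n$: $e_1\cdot e_1=e_1$ and $e_1\cdot e_i=e_i$ for $2\le i\le n$; \item $J_3$, with basis $e_1,\dots,e_n$: $e_1\cdot e_2=e_3$ (that is, $J_3=\{e_1,e_2,e_3\}\oplus\mathfrak{a}_{n-3}$). \end{itemize}
   Context: All algebras are finite-dimensional over $\mathbb{C}$. An $n$-dimensional algebra structure on an $n$-dimensional complex vector space $V$ is an element $\lambda\in \mathrm{Hom}(V\otimes V,V)$. The group $GL_n(\mathbb{C})=GL(V)$ acts on algebra structures by $(g*\lambda)(x,y)=g\big(\lambda(g^{-1}(x),g^{-1}(y))\big)$, and $\mathrm{Orb}(\lambda)$ denotes the orbit of $\lambda$ (its isomorphism class). Degeneration: $\lambda$ degenerates to $\mu$, written $\lambda\to\mu$, if $\mathrm{Orb}(\mu)$ lies in the Zariski closure of $\mathrm{Orb}(\lambda)$. A degeneration $\lambda\to\mu$ is trivial if $\lambda$ and $\mu$ are isomorphic. A non-trivial degeneration $\lambda\to\mu$ is direct if there is no chain of non-trivial degenerations $\lambda\to\nu\to\mu$. Let $\mathfrak{a}_n$ denote the $n$-dimensional algebra with zero multiplication; every $n$-dimensional algebra degenerates to $\mathfrak{a}_n$.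 The level of an $n$-dimensional algebra $\lambda$ is the maximum length (number of arrows) of a chain of direct degenerations starting at $\lambda$ and ending at $\mathfrak{a}_n$. In multiplication tables, omitted products of basis elements are zero, except that products obtained from the listed ones by commutativity of the Jordan product are also omitted. *)

(* Defs.v *)
From HB Require Import structures.
From mathcomp Require Import all_boot all_order all_algebra.
From mathcomp Require Import reals complex mpoly.

Set Implicit Arguments.
Unset Strict Implicit.
Unset Printing Implicit Defensive.

Import GRing.Theory.
Local Open Scope ring_scope.

Section Zariski.
Variables (K : fieldType) (W : vectType K).

(* Polynomial functions on W, written in the coordinates of a basis of W; the
   class of these functions does not depend on the basis. *)
Definition poly_eval (p : {mpoly K[\dim {:W}]}) (w : W) : K :=
  p.@[fun i => coord (vbasis {:W}) i w].

Definition zariski_closed (A : W -> Prop) : Prop :=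
  exists P : {mpoly K[\dim {:W}]} -> Prop,
    forall w, A w <-> (forall p, P p -> poly_eval p w = 0).

Definition zariski_closure (S : W -> Prop) (w : W) : Prop :=
  forall A, zariski_closed A -> (forall s, S s -> A s) -> A w.

End Zariski.

Section Algebras.
Variables (K : fieldType) (V : vectType K).

(* Hom(V (x) V, V) in curried form: the product of x and y is [lam x y]. *)
Definition algebra : vectType K := 'Hom(V, 'Hom(V, V)).

Definition bilinear_algebra (m : V -> V -> V) : algebra :=
  linfun (fun x => linfun (m x)).

Lemma bilinear_algebraE (m : V -> V -> V) :
  (forall x, linear (m x)) -> (forall y, linear (m^~ y)) ->
  forall x y, bilinear_algebra m x y = m x y.
Proof.
move=> ml mr.
pose ml' x : {linear V -> V} :=
  HB.pack (m x) (GRing.isLinear.Build K V V *:%R (m x) (ml x)).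
have mlE x y : linfun (m x) y = m x y by exact: (lfunE (ml' x)).
pose f x : 'Hom(V, V) := linfun (m x).
have fl : linear f.
  by move=> a u v; apply/lfunP=> y; rewrite !lfunE /= /f !mlE mr scale_lfunE mlE.
pose f' : {linear V -> 'Hom(V, V)} :=
  HB.pack f (GRing.isLinear.Build K V _ *:%R f fl).
by move=> x y; rewrite /bilinear_algebra (lfunE f') /= /f mlE.
Qed.

Definition GL (g : 'End(V)) : Prop := lker g = 0%VS.

Definition act (g : 'End(V)) (lam : algebra) : algebra :=
  bilinear_algebra (fun x y => g (lam ((g^-1)%VF x) ((g^-1)%VF y))).

Lemma actE g lam x y : act g lam x y = g (lam ((g^-1)%VF x) ((g^-1)%VF y)).
Proof.
apply: (@bilinear_algebraE (fun x y => g (lam (g^-1%VF x) (g^-1%VF y)))).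
  by move=> {}x a u v; rewrite !linearP.
by move=> {}y a u v; rewrite /= !linearP add_lfunE scale_lfunE linearP.
Qed.

Definition Orb (lam mu : algebra) : Prop := exists2 g, GL g & mu = act g lam.

Definition isomorphic (lam mu : algebra) : Prop := Orb lam mu.

Definition degenerates (lam mu : algebra) : Prop :=
  forall nu, Orb mu nu -> zariski_closure (Orb lam) nu.

Definition nontrivial_degeneration (lam mu : algebra) : Prop :=
  degenerates lam mu /\ ~ isomorphic lam mu.

Definition direct_degeneration (lam mu : algebra) : Prop :=
  nontrivial_degeneration lam mu /\
  ~ (exists nu, nontrivial_degeneration lam nu /\
                nontrivial_degeneration nu mu).

Inductive direct_chain : nat -> algebra -> algebra -> Prop :=
| direct_chain0 lam : direct_chain 0 lam lam
| direct_chainS k lam mu nu :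
    direct_degeneration lam mu -> direct_chain k mu nu ->
    direct_chain k.+1 lam nu.

(* The zero element of [algebra] is the algebra with zero multiplication. *)
Definition has_level (lam : algebra) (k : nat) : Prop :=
  direct_chain k lam 0 /\ (forall l, direct_chain l lam 0 -> (l <= k)%N).

Definition jordan (lam : algebra) : Prop :=
  (forall x y, lam x y = lam y x) /\
  (forall x y, lam (lam x y) (lam x x) = lam x (lam y (lam x x))).

Section Tables.
Variables (n : nat) (e : n.-tuple V).

Definition table_algebra (t : nat -> nat -> V) : algebra :=
  bilinear_algebra (fun x y =>
    \sum_(i < n) \sum_(j < n) (coord e i x * coord e j y) *: t i j).

Lemma table_algebraE t (i j : 'I_n) :
  basis_of fullv e -> table_algebra t e`_i e`_j = t i j.
Proof.
move=> be; have fe := basis_free be.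
rewrite bilinear_algebraE; last first.
- move=> y a u v; rewrite scaler_sumr -big_split; apply: eq_bigr => k _ /=.
  rewrite scaler_sumr -big_split; apply: eq_bigr => l _ /=.
  by rewrite linearP mulrDl scalerDl -mulrA scalerA.
- move=> x a u v; rewrite scaler_sumr -big_split; apply: eq_bigr => k _ /=.
  rewrite scaler_sumr -big_split; apply: eq_bigr => l _ /=.
  by rewrite linearP mulrDr scalerDl mulrCA scalerA.
rewrite (bigD1 i) //= (bigD1 j) //= !coord_free // !eqxx mulr1 scale1r.
rewrite big1 ?addr0 => [|l nlj]; last first.
  by rewrite !coord_free // [j == l]eq_sym (negPf nlj) mulr0 scale0r.
rewrite big1 ?addr0 // => k nki; rewrite big1 // => l _.
by rewrite !coord_free // [i == k]eq_sym (negPf nki) mul0r scale0r.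
Qed.

(* The basis vectors e_1, ..., e_n (for [J1]: e, f_2, ..., f_n) are numbered
   from 0: they are e`_0, ..., e`_n.-1. *)
Definition J1 : algebra := table_algebra (fun i j =>
  match i, j with
  | 0%N, 0%N => e`_0
  | _, _ => 0
  end).

Definition J2 : algebra := table_algebra (fun i j =>
  match i, j with
  | 0%N, k | k, 0%N => e`_k
  | _, _ => 0
  end).

Definition J3 : algebra := table_algebra (fun i j =>
  match i, j with
  | 0%N, 1%N | 1%N, 0%N => e`_2
  | _, _ => 0
  end).

End Tables.

End Algebras.

(* Main.v *)
Require Import Defs.
From HB Require Import structures.
From mathcomp Require Import all_boot all_order all_algebra perm.
From mathcomp Require Import reals complex mpoly ring.
From Stdlib Require Import Classical.

(** Degenerations can only be obstructed by closed conditions and produced by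
curves, and here a few of each are enough.

Five shapes of commutative product are singled out, each written without a basis
by means of linear functionals: [null_form] (e1 e1 = e2), [half_form] (e1 e1 = e1,
e1 ei = ei / 2), and [idem_form], [unit_form], [hyper_form], which are J_1, J_2 and
J_3. Two algebras of the same form are isomorphic, because dual systems of vectors
and functionals can be carried to each other by GL(V).

Producing degenerations. Contracting along a splitting V = U + M + K c with weights
2, 3, 4 sends a product to its c-component restricted to U
([degenerates_projection]). Hence any algebra with some x x outside the line of x
degenerates to [null_form], and any commutative algebra for which some functional f
and some x, y in ker f satisfy f(xy)^2 <> f(xx) f(yy) degenerates to J_3.

The key step is that the remaining Jordan algebras are few
([low_rank_classification]): if f(xy)^2 = f(xx) f(yy) whenever f(x) = f(y) = 0,
a nonzero Jordan algebra of dimension at least 3 has one of the four other forms.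
If there is an idempotent e, then e y lies in the span of e and y for every y, so the
Peirce decomposition with respect to e has a single piece besides the line of e:
A_0 gives J_1, A_{1/2} gives [half_form], A_1 gives J_2. If there is none,
the algebra is nil and has the form [null_form].

A Jordan algebra that degenerates to [half_form] is already of that form
([half_form_open]): if the operator L_x^2 - L_{xx} has corank one, which is an open
condition on the product, its kernel contains x and xx, so that xx is a multiple of
x, and a multiple of x is an idempotent e with e y = y / 2 modulo e.

Now let lam have level two, with lam -> mu -> 0 direct. The algebra mu is Jordan and
cannot have [half_form], hence it degenerates to [null_form], hence it has that form
since mu -> 0 is direct. If lam is none of J_1, J_2, J_3, it degenerates
non-trivially to J_3 and J_3 degenerates to mu, so that lam -> mu was not direct.
Conversely, closed conditions (square and rank conditions on the product, vanishing
of triple products, a trace identity) show that the only proper degenerations of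
J_1, J_2, J_3 are [null_form] and 0, and that [null_form] degenerates properly to 0
only; so the longest chains from J_i have length two. *)

Set Implicit Arguments.
Unset Strict Implicit.
Unset Printing Implicit Defensive.

Import GRing.Theory Num.Theory.
Local Open Scope ring_scope.

(** * Linear functionals on a finite-dimensional space *)

Section Functionals.
Variables (K : fieldType) (V : vectType K).

Lemma functional_of (h : V -> K) :
  scalar h -> exists f : {scalar V}, forall v, f v = h v.
Proof.
move=> hl.
pose f : {scalar V} := HB.pack h (GRing.isLinear.Build K V K *%R h hl).
by exists f.
Qed.

(** The span is cut out by functionals: otherwise a coordinate of the projection of [w]
along the span is non-zero. Most vector identities below are obtained by applying a
generic functional and computing in the field. *)
Lemma mem_span_functional (X : seq V) w :
  (forall f : {scalar V}, {in X, forall x, f x = 0} -> f w = 0) ->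
  w \in <<X>>%VS.
Proof.
move=> h; apply: contraT => wX.
pose P := projv <<X>>%VS.
have [i ni] : exists i, coord (vbasis {:V}) i (w - P w) != 0.
  apply: NNPP => hn.
  have w0 : w - P w = 0.
    rewrite (coord_vbasis (memvf (w - P w))) big1 // => i _.
    case: (eqVneq (coord (vbasis fullv) i (w - P w)) 0) => [->|ni].
      by rewrite scale0r.
    by case: hn; exists i.
  have : w \in <<X>>%VS by rewrite (subr0_eq w0) memv_proj.
  by rewrite (negPf wX).
have [f fE] : exists f : {scalar V},
    forall v, f v = coord (vbasis {:V}) i (v - P v).
  apply: functional_of => a u v.
  have -> : a *: u + v - P (a *: u + v) = a *: (u - P u) + (v - P v).
    by rewrite linearP scalerBr opprD addrACA.
  by rewrite linearP.
case/eqP: ni; rewrite -fE; apply: h => x Xx.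
by rewrite fE projv_id ?subrr ?linear0 // memv_span.
Qed.

Lemma functional_ext (u v : V) : (forall f : {scalar V}, f u = f v) -> u = v.
Proof.
move=> h; apply: subr0_eq; apply/eqP; rewrite -memv0 -span_nil.
by apply: mem_span_functional => f _; rewrite linearB /= h subrr.
Qed.

Lemma functional_span1 (x w : V) :
  (forall f : {scalar V}, f x = 0 -> f w = 0) -> exists a, w = a *: x.
Proof.
move=> h; have : w \in <<[:: x]>>%VS.
  by apply: mem_span_functional => f fX; apply: h; rewrite fX ?inE.
by rewrite span_seq1 => /vlineP.
Qed.

Lemma functional_span2 (x y w : V) :
  (forall f : {scalar V}, f x = 0 -> f y = 0 -> f w = 0) ->
  exists a b, w = a *: x + b *: y.
Proof.
move=> h; have : w \in <<[:: x; y]>>%VS.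
  by apply: mem_span_functional => f fX; apply: h; rewrite fX ?inE ?eqxx ?orbT.
rewrite span_cons span_seq1 => /memv_addP[u /vlineP[a ->]] [v /vlineP[b ->] ->].
by exists a, b.
Qed.

Lemma functional_span3 (x y z w : V) :
  (forall f : {scalar V}, f x = 0 -> f y = 0 -> f z = 0 -> f w = 0) ->
  exists a b c, w = a *: x + b *: y + c *: z.
Proof.
move=> h; have : w \in <<[:: x; y; z]>>%VS.
  by apply: mem_span_functional => f fX; apply: h; rewrite fX ?inE ?eqxx ?orbT.
rewrite span_cons => /memv_addP[u /vlineP[a ->]] [v].
rewrite span_cons span_seq1.
case/memv_addP=> u' /vlineP[b ->] [v' /vlineP[c ->] ->] ->.
by exists a, b, c; rewrite addrA.
Qed.

(** The coordinates along a free family extend linearly to the whole space, whether or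
not the family is a basis. *)
Lemma functional_values n (X : n.-tuple V) (a : 'I_n -> K) :
  free X -> exists f : {scalar V}, forall i : 'I_n, f X`_i = a i.
Proof.
move=> fX.
have [f fE] : exists f : {scalar V},
    forall v, f v = \sum_(i < n) a i * coord X i v.
  apply: functional_of => k u v; rewrite mulr_sumr -big_split /=.
  by apply: eq_bigr => i _; rewrite linearP mulrDr mulrCA.
exists f => i; rewrite fE (bigD1 i) //= coord_free // eqxx mulr1.
by rewrite big1 ?addr0 // => j ji; rewrite coord_free // eq_sym (negPf ji) mulr0.
Qed.

Lemma functional_values1 (x : V) a :
  x != 0 -> exists f : {scalar V}, f x = a.
Proof.
rewrite -seq1_free => x0.
have [f fE] := @functional_values 1 [tuple x] (fun=> a) x0.
by exists f; rewrite -(fE ord0).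
Qed.

Lemma functional_values2 (x y : V) a b : free [:: x; y] ->
  exists f : {scalar V}, f x = a /\ f y = b.
Proof.
move=> xy; have [f fE] :=
  @functional_values 2 [tuple x; y] (fun i => [:: a; b]`_i) xy.
by exists f; split; [exact: (fE ord0) | exact: (fE (lift ord0 ord0))].
Qed.

Lemma functional_values3 (x y z : V) a b c : free [:: x; y; z] ->
  exists f : {scalar V}, [/\ f x = a, f y = b & f z = c].
Proof.
move=> xyz; have [f fE] :=
  @functional_values 3 [tuple x; y; z] (fun i => [:: a; b; c]`_i) xyz.
exists f; split; first exact: (fE ord0).
  exact: (fE (lift ord0 ord0)).
exact: (fE (lift ord0 (lift ord0 ord0))).
Qed.

Lemma free2P (x y : V) :
  x != 0 -> (forall a, y <> a *: x) -> free [:: x; y].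
Proof.
move=> x0 hy; rewrite -[[:: x; y]]/(rcons [:: x] y) -cats1.
rewrite (perm_free (permEl (perm_catC _ _))) /= free_cons seq1_free x0 andbT.
by rewrite span_seq1; apply/negP=> /vlineP[a /hy].
Qed.

Lemma free3P (x y z : V) :
  free [:: x; y] -> (forall a b, z <> a *: x + b *: y) -> free [:: x; y; z].
Proof.
move=> xy hz; rewrite -[[:: x; y; z]]/(rcons [:: x; y] z) -cats1.
rewrite (perm_free (permEl (perm_catC _ _))) /= free_cons xy andbT.
apply/negP; rewrite span_cons span_seq1.
by case/memv_addP=> u /vlineP[a ->] [v /vlineP[b ->]] /hz.
Qed.

End Functionals.

(** * Polynomial functions and Zariski closure *)

Section PolynomialFunctions.
Variables (K : fieldType) (W : vectType K).

(** Evaluating a polynomial at functions stays in any class of functions that contains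
the constants and is closed under sum and product; used below for polynomial
functions on a space and for polynomial functions of one parameter. *)
Lemma meval_closed (X : Type) (Q : (X -> K) -> Prop) n (v : 'I_n -> X -> K) :
  (forall a, Q (fun=> a)) ->
  (forall F G, Q F -> Q G -> Q (fun x => F x + G x)) ->
  (forall F G, Q F -> Q G -> Q (fun x => F x * G x)) ->
  (forall F G, F =1 G -> Q F -> Q G) ->
  (forall i, Q (v i)) ->
  forall p : {mpoly K[n]}, Q (fun x => p.@[fun i => v i x]).
Proof.
move=> Qc QD QM Qe Qv p.
have Qsum (I : Type) (r : seq I) (F : I -> X -> K) :
    (forall i, Q (F i)) -> Q (fun x => \sum_(i <- r) F i x).
  move=> QF; elim: r => [|i r IH].
    by apply: Qe (Qc 0) => x; rewrite big_nil.
  by apply: Qe (QD _ _ (QF i) IH) => x; rewrite big_cons.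
have Qprod (I : Type) (r : seq I) (F : I -> X -> K) :
    (forall i, Q (F i)) -> Q (fun x => \prod_(i <- r) F i x).
  move=> QF; elim: r => [|i r IH].
    by apply: Qe (Qc 1) => x; rewrite big_nil.
  by apply: Qe (QM _ _ (QF i) IH) => x; rewrite big_cons.
have Qexp F k : Q F -> Q (fun x => F x ^+ k).
  move=> QF; elim: k => [|k IH]; first exact: Qc.
  by apply: Qe (QM _ _ QF IH) => x; rewrite exprS.
apply: (Qe (fun x => \sum_(m <- msupp p) p@_m * \prod_i v i x ^+ m i)).
  by move=> x; rewrite mevalE.
by apply: Qsum => m; apply: QM (Qc _) _; apply: Qprod => i; apply: Qexp.
Qed.

Definition polyfun (F : W -> K) := exists p, forall w, F w = poly_eval p w.

Lemma polyfun_ext F G : F =1 G -> polyfun F -> polyfun G.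
Proof. by move=> FG [p pE]; exists p => w; rewrite -FG. Qed.

Lemma polyfun_cst a : polyfun (fun=> a).
Proof. by exists a%:MP => w; rewrite /poly_eval mevalC. Qed.

Lemma polyfunD F G : polyfun F -> polyfun G -> polyfun (fun w => F w + G w).
Proof.
by move=> [p pE] [q qE]; exists (p + q) => w; rewrite /poly_eval mevalD pE qE.
Qed.

Lemma polyfunM F G : polyfun F -> polyfun G -> polyfun (fun w => F w * G w).
Proof.
by move=> [p pE] [q qE]; exists (p * q) => w; rewrite /poly_eval mevalM pE qE.
Qed.

Lemma polyfunN F : polyfun F -> polyfun (fun w => - F w).
Proof.
move=> pF; apply: polyfun_ext (polyfunM (polyfun_cst (-1)) pF) => w.
by rewrite mulN1r.
Qed.

Lemma polyfunB F G : polyfun F -> polyfun G -> polyfun (fun w => F w - G w).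
Proof. by move=> pF pG; apply: polyfunD => //; apply: polyfunN. Qed.

Lemma polyfunX F k : polyfun F -> polyfun (fun w => F w ^+ k).
Proof.
move=> pF; elim: k => [|k IH]; first exact: polyfun_cst.
by apply: polyfun_ext (polyfunM pF IH) => w; rewrite exprS.
Qed.

Lemma polyfun_sum (I : Type) (r : seq I) (F : I -> W -> K) :
  (forall i, polyfun (F i)) -> polyfun (fun w => \sum_(i <- r) F i w).
Proof.
move=> pF; elim: r => [|i r IH].
  by apply: polyfun_ext (polyfun_cst 0) => w; rewrite big_nil.
by apply: polyfun_ext (polyfunD (pF i) IH) => w; rewrite big_cons.
Qed.

Lemma polyfun_prod (I : Type) (r : seq I) (F : I -> W -> K) :
  (forall i, polyfun (F i)) -> polyfun (fun w => \prod_(i <- r) F i w).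
Proof.
move=> pF; elim: r => [|i r IH].
  by apply: polyfun_ext (polyfun_cst 1) => w; rewrite big_nil.
by apply: polyfun_ext (polyfunM (pF i) IH) => w; rewrite big_cons.
Qed.

Lemma polyfun_det n (F : 'I_n -> 'I_n -> W -> K) :
  (forall i j, polyfun (F i j)) -> polyfun (fun w => \det (\matrix_(i, j) F i j w)).
Proof.
move=> pF; apply: polyfun_sum => s; apply: polyfunM; first exact: polyfun_cst.
apply: (@polyfun_ext (fun w => \prod_i F i (s i) w)); last first.
  exact: polyfun_prod.
by move=> w; apply: eq_bigr => i _; rewrite mxE.
Qed.

Lemma polyfun_linear (F : W -> K) : scalar F -> polyfun F.
Proof.
move=> /functional_of[f fE].
apply: (@polyfun_ext (fun w =>
  \sum_i coord (vbasis {:W}) i w * f (vbasis {:W})`_i)).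
  move=> w; rewrite -fE [in RHS](coord_vbasis (memvf w)) linear_sum /=.
  by apply: eq_bigr => i _; rewrite linearZ.
apply: polyfun_sum => i; apply: polyfunM; last exact: polyfun_cst.
by exists 'X_i => w; rewrite /poly_eval mevalXU.
Qed.

Lemma closure_polyfun (S : W -> Prop) (F : W -> K) w :
  polyfun F -> (forall s, S s -> F s = 0) -> zariski_closure S w -> F w = 0.
Proof.
move=> [p pE] FS /(_ (fun w => F w = 0)); apply=> //.
exists (eq p) => u; split=> [Fu q <-|/(_ p erefl)]; by rewrite -pE.
Qed.

Lemma closure_id (S : W -> Prop) w : S w -> zariski_closure S w.
Proof. by move=> Sw A _; apply. Qed.

(** Polynomial functions pull back along linear maps, so a linear map that preserves [S]
preserves its closure. *)
Lemma closure_linear (S : W -> Prop) (g : W -> W) w :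
  linear g -> (forall s, S s -> S (g s)) ->
  zariski_closure S w -> zariski_closure S (g w).
Proof.
move=> gl gS Sw A [P PE] AS; apply/PE => p Pp.
have pg : polyfun (fun u => poly_eval p (g u)).
  apply: (@meval_closed _ polyfun); try by [exact: polyfun_cst
    |exact: polyfunD |exact: polyfunM |exact: polyfun_ext].
  by move=> i; apply: polyfun_linear => a u v; rewrite gl linearP.
apply: closure_polyfun pg _ Sw => s Ss.
by move/PE: (AS _ (gS _ Ss)); apply.
Qed.

(** A polynomial vanishing on [S] becomes, along the curve, a polynomial in [t] with
infinitely many roots in characteristic 0, hence it also vanishes at [t = 0]. *)
Lemma closure_curve (S : W -> Prop) (I : finType) (d : I -> nat) (u : I -> W) w :
  (forall m : nat, m%:R = 0 :> K -> m = 0%N) ->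
  (forall t, t != 0 -> S (\sum_i t ^+ d i *: u i)) ->
  w = \sum_(i | d i == 0%N) u i -> zariski_closure S w.
Proof.
move=> char0 Su wE A [P PE] AS; apply/PE => p Pp.
pose F t := \sum_i t ^+ d i *: u i.
have -> : w = F 0.
  rewrite wE /F [RHS](bigID (fun i => d i == 0%N)) /= [X in _ + X]big1 ?addr0.
    by apply: eq_bigr => i /eqP->; rewrite scale1r.
  by move=> i /negPf di; rewrite expr0n di scale0r.
have [q qE] : exists q : {poly K}, forall t, poly_eval p (F t) = q.[t].
  apply: (@meval_closed K (fun G => exists q : {poly K}, forall t, G t = q.[t])).
  - by move=> a; exists a%:P => t; rewrite hornerC.
  - by move=> G H [q qE] [r rE]; exists (q + r) => t; rewrite hornerD qE rE.
  - by move=> G H [q qE] [r rE]; exists (q * r) => t; rewrite hornerM qE rE.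
  - by move=> G H GH [q qE]; exists q => t; rewrite -GH.
  move=> i; exists (\sum_j coord (vbasis {:W}) i (u j) *: 'X^(d j)) => t.
  rewrite linear_sum horner_sum; apply: eq_bigr => j _.
  by rewrite linearZ hornerZ hornerXn mulrC.
rewrite qE; suff -> : q = 0 by rewrite horner0.
apply/eqP/negPn/negP => q0.
(* The positive integers up to the size of q are too many roots for q <> 0. *)
pose r : seq K := [seq m.+1%:R | m <- iota 0 (size q)].
have := @max_poly_roots _ q r q0; rewrite size_map size_iota ltnn.
move=> h; suff: false by []. apply: h.
  apply/allP=> _ /mapP[m _ ->]; apply/eqP; rewrite -qE.
  have m0 : m.+1%:R != 0 :> K by apply/eqP => /char0.
  by move/PE: (AS _ (Su _ m0)); apply.
rewrite map_inj_uniq ?iota_uniq //.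
have inj (a b : nat) : (a <= b)%N -> a.+1%:R = b.+1%:R :> K -> a = b.
  move=> ab /eqP; rewrite eq_sym -subr_eq0 -natrB ?subSS ?ltnS //.
  by move/eqP/char0/eqP; rewrite subn_eq0 => ba; apply/eqP; rewrite eqn_leq ab.
move=> a b ab; case/orP: (leq_total a b) => le; first exact: inj.
by apply/esym/inj.
Qed.

End PolynomialFunctions.

(** * Orbits and degenerations of algebra structures *)

Section Bilinear.
Variables (K : fieldType) (V : vectType K).
Implicit Types (lam mu nu : algebra V) (f : {scalar V}).

Lemma algDl lam x y z : lam (x + y) z = lam x z + lam y z.
Proof. by rewrite linearD add_lfunE. Qed.
Lemma algDr lam x y z : lam x (y + z) = lam x y + lam x z.
Proof. exact: linearD. Qed.
Lemma algZl lam a x y : lam (a *: x) y = a *: lam x y.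
Proof. by rewrite linearZ scale_lfunE. Qed.
Lemma algZr lam a x y : lam x (a *: y) = a *: lam x y.
Proof. exact: linearZ. Qed.
Lemma algNl lam x y : lam (- x) y = - lam x y.
Proof. by rewrite linearN opp_lfunE. Qed.
Lemma algNr lam x y : lam x (- y) = - lam x y.
Proof. exact: linearN. Qed.
Lemma alg0l lam y : lam 0 y = 0.
Proof. by rewrite linear0 zero_lfunE. Qed.
Lemma alg0r lam x : lam x 0 = 0.
Proof. exact: linear0. Qed.

Definition algE := (algDl, algDr, algZl, algZr, algNl, algNr, alg0l, alg0r).

Lemma scalarD f x y : f (x + y) = f x + f y. Proof. exact: linearD. Qed.
Lemma scalarN f x : f (- x) = - f x. Proof. exact: linearN. Qed.
Lemma scalar0 f : f 0 = 0. Proof. exact: linear0. Qed.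
Lemma scalarM f a x : f (a *: x) = a * f x. Proof. exact: linearZ. Qed.

Definition scalE f := (scalarD f, scalarN f, scalar0 f, scalarM f).

Lemma algebra_ext lam mu : (forall x y, lam x y = mu x y) -> lam = mu.
Proof. by move=> h; apply/lfunP=> x; apply/lfunP=> y. Qed.

Lemma algebra_addE lam mu x y : (lam + mu) x y = lam x y + mu x y.
Proof. by rewrite -add_lfunE; congr (fun_of_lfun _ y); apply: add_lfunE. Qed.

Lemma algebra_scaleE a lam x y : (a *: lam) x y = a *: lam x y.
Proof. by rewrite -scale_lfunE; congr (fun_of_lfun _ y); apply: scale_lfunE. Qed.

Lemma act_linear (g : 'End(V)) : linear (act g).
Proof.
move=> a lam mu; apply: algebra_ext => x y.
by rewrite actE !algebra_addE !algebra_scaleE !actE linearP.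
Qed.

Lemma GL_invL (g : 'End(V)) : GL g -> cancel g (g^-1)%VF.
Proof. by move=> /eqP g0; apply: lker0_lfunK. Qed.

Lemma GL_invR (g : 'End(V)) : GL g -> cancel (g^-1)%VF g.
Proof. by move=> /eqP g0; apply: lker0_lfunVK. Qed.

(** Orbits in terms of a pair of mutually inverse linear functions, which spares the
partial inverse of ['End(V)]. *)
Lemma OrbP lam mu :
  Orb lam mu <-> exists g h : V -> V,
    [/\ linear g, linear h, cancel g h, cancel h g
       & forall x y, mu x y = g (lam (h x) (h y))].
Proof.
split=> [[g gl ->]|[g [h [gl hl gK hK muE]]]].
  exists g, (g^-1)%VF; split; [exact: linearP|exact: linearP| | |exact: actE].
    exact: GL_invL.
  exact: GL_invR.
pose gL : {linear V -> V} := HB.pack g (GRing.isLinear.Build K V V *:%R g gl).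
have gE x : linfun gL x = g x by rewrite lfunE.
have glG : GL (linfun gL).
  by apply/eqP/lker0P=> x y; rewrite !gE; apply: can_inj gK _ _.
exists (linfun gL) => //; apply: algebra_ext => x y.
have iE u : ((linfun gL)^-1)%VF u = h u.
  by apply: (can_inj (GL_invL glG)); rewrite (GL_invR glG) gE hK.
by rewrite actE !iE gE.
Qed.

Lemma Orb_refl lam : Orb lam lam.
Proof. by apply/OrbP; exists id, id; split. Qed.

Lemma Orb_sym lam mu : Orb lam mu -> Orb mu lam.
Proof.
move=> /OrbP[g [h [gl hl gK hK muE]]]; apply/OrbP; exists h, g; split=> // x y.
by rewrite muE gK !gK.
Qed.

Lemma Orb_trans lam mu nu : Orb lam mu -> Orb mu nu -> Orb lam nu.
Proof.
move=> /OrbP[g [h [gl hl gK hK muE]]] /OrbP[g' [h' [gl' hl' gK' hK' nuE]]].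
apply/OrbP; exists (g' \o g), (h \o h'); split=> /=.
- by move=> a u v /=; rewrite gl gl'.
- by move=> a u v /=; rewrite hl' hl.
- by move=> x /=; rewrite gK' gK.
- by move=> x /=; rewrite hK hK'.
by move=> x y; rewrite nuE muE.
Qed.

(** The closure of an orbit is stable under GL(V), so one point of the target orbit is
enough. *)
Lemma degenerates_closure lam mu :
  zariski_closure (Orb lam) mu -> degenerates lam mu.
Proof.
move=> h nu [g gG ->]; apply: closure_linear h; first exact: act_linear.
by move=> s /Orb_trans; apply; exists g.
Qed.

Lemma degenerates_in lam mu : degenerates lam mu -> zariski_closure (Orb lam) mu.
Proof. by apply; apply: Orb_refl. Qed.

Lemma degenerates_Orb lam mu : Orb lam mu -> degenerates lam mu.
Proof. by move=> h; apply: degenerates_closure; apply: closure_id. Qed.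

Lemma degenerates_trans lam mu nu :
  degenerates lam mu -> degenerates mu nu -> degenerates lam nu.
Proof.
move=> h1 h2 rho /h2 rhoC A clA lamA; apply: rhoC => // s ms; exact: h1.
Qed.

(** A map into [V] is polynomial when all functionals make it so. Such maps are closed
under the product itself ([polymap_alg]), so every nonassociative monomial is
polynomial in the product. *)
Definition polymap (G : algebra V -> V) :=
  forall f, polyfun (fun lam => f (G lam)).

Lemma polymap_cst v : polymap (fun=> v).
Proof. by move=> f; apply: polyfun_cst. Qed.

Lemma polymapD F G : polymap F -> polymap G -> polymap (fun w => F w + G w).
Proof.
move=> pF pG f; apply: polyfun_ext (polyfunD (pF f) (pG f)) => w.
by rewrite scalarD.
Qed.

Lemma polymapN F : polymap F -> polymap (fun w => - F w).
Proof.
by move=> pF f; apply: polyfun_ext (polyfunN (pF f)) => w; rewrite scalarN.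
Qed.

Lemma polymap_alg F G :
  polymap F -> polymap G -> polymap (fun lam : algebra V => lam (F lam) (G lam)).
Proof.
move=> pF pG f.
pose b := vbasis {:V}.
apply: (@polyfun_ext _ _ (fun lam : algebra V => \sum_i \sum_j
   (coord b i (F lam) * coord b j (G lam)) * f (lam b`_i b`_j))).
  move=> lam; rewrite [in RHS](coord_vbasis (memvf (F lam))).
  rewrite linear_sum sum_lfunE linear_sum /=; apply: eq_bigr => i _.
  rewrite [in RHS](coord_vbasis (memvf (G lam))) linear_sum linear_sum /=.
  by apply: eq_bigr => j _; rewrite !algE !scalE; ring.
apply: polyfun_sum => i; apply: polyfun_sum => j; apply: polyfunM.
  by apply: polyfunM; [apply: pF | apply: pG].
apply: polyfun_linear => a u v.
by rewrite algebra_addE algebra_scaleE !scalE.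
Qed.

End Bilinear.

Ltac solve_polymap := repeat first [exact: polymap_cst | apply: polymapD
  | apply: polymapN | apply: polymap_alg].
Ltac solve_polyfun := repeat first [exact: polyfun_cst | apply: polyfunD
  | apply: polyfunN | apply: polyfunX | apply: polyfunM
  | match goal with |- polyfun (fun w => _ (@?G w)) =>
      refine ((_ : polymap G) _); solve_polymap end].

(** * Transporting dual systems by linear automorphisms *)

Section DualSystems.
Variables (K : fieldType) (V : vectType K) (k : nat).
Implicit Types (x : 'I_k -> V) (f : 'I_k -> {scalar V}).

Definition dual_system x f := forall i j, f i (x j) = (i == j)%:R.

(** The projection [v - \sum_i f i v *: x i] has the common kernel of the functionals
as its image; a basis of it completes the [x i]. *)
Lemma dual_system_basis x f : dual_system x f ->
  exists Y : seq V, basis_of fullv ([tuple x i | i < k] ++ Y) /\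
    {in Y, forall y i, f i y = 0}.
Proof.
move=> fx; set X := [tuple x i | i < k].
have fX i (j : 'I_k) : f i X`_j = (i == j)%:R by rewrite -tnth_nth tnth_mktuple.
pose p v := v - \sum_i f i v *: x i.
have pl : linear p.
  move=> a u v; rewrite /p scalerBr addrACA -opprD; congr (_ - _).
  rewrite scaler_sumr -big_split; apply: eq_bigr => i _ /=.
  by rewrite !scalE scalerDl scalerA.
pose P : {linear V -> V} := HB.pack p (GRing.isLinear.Build K V V *:%R p pl).
have PE v : linfun P v = p v by rewrite lfunE.
have fp i v : f i (p v) = 0.
  rewrite /p !scalE linear_sum (bigD1 i) //= big1 => [|j ji].
    by rewrite scalarM fx eqxx mulr1 addr0 subrr.
  by rewrite scalarM fx eq_sym (negPf ji) mulr0.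
have fU v i : v \in limg (linfun P) -> f i v = 0.
  by case/memv_imgP=> u _ ->; rewrite PE fp.
have freeX : free X.
  apply/freeP => a a0 i; have := congr1 (f i) a0.
  rewrite linear_sum scalar0 (bigD1 i) //= big1 => [|j ji].
    by rewrite scalarM fX eqxx mulr1 addr0.
  by rewrite scalarM fX eq_sym (negPf ji) mulr0.
exists (vbasis (limg (linfun P))); split; last by move=> y /vbasis_mem /fU.
have bU := vbasisP (limg (linfun P)).
rewrite /basis_of span_cat (span_basis bU) cat_free freeX (basis_free bU) /=.
apply/andP; split.
  rewrite eqEsubv subvf /=; apply/subvP => v _.
  have -> : v = \sum_i f i v *: x i + p v by rewrite addrC subrK.
  apply: memv_add; last by rewrite -PE memv_img ?memvf.
  apply: memv_suml => i _; apply: memvZ; apply: memv_span.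
  by rewrite -(tnth_mktuple x i) mem_tnth.
rewrite (span_basis bU).
apply/directv_addP/eqP; rewrite -subv0; apply/subvP => v.
rewrite memv_cap memv0 => /andP[vX' vU].
have vX : v \in <<X>>%VS by [].
rewrite (coord_span vX) big1 // => i _.
suff -> : coord X i v = f i v by rewrite fU ?scale0r.
rewrite [in RHS](coord_span vX) linear_sum (bigD1 i) //= big1 => [|j ji].
  by rewrite scalarM fX eqxx mulr1 addr0.
by rewrite scalarM fX eq_sym (negPf ji) mulr0.
Qed.

(** Any two dual systems of the same length are conjugate under GL(V): map one adapted
basis to the other. This is the only source of isomorphisms used below. *)
Lemma dual_system_transport x x' f f' :
  dual_system x f -> dual_system x' f' ->
  exists g h : V -> V, [/\ linear g, linear h, cancel g h & cancel h g] /\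
    (forall i, g (x i) = x' i) /\ (forall i v, f' i (g v) = f i v).
Proof.
move=> /[dup] fx /dual_system_basis[Y [bX Yf]].
move=> /[dup] fx' /dual_system_basis[Y' [bX' Yf']].
set X := [tuple x i | i < k] in bX; set X' := [tuple x' i | i < k] in bX'.
pose d := \dim {:V}.
have sb : size (X ++ Y) == d.
  by rewrite /d -(span_basis bX) eq_sym; have := basis_free bX; rewrite /free.
have sb' : size (X' ++ Y') == d.
  by rewrite /d -(span_basis bX') eq_sym; have := basis_free bX'; rewrite /free.
pose b : d.-tuple V := Tuple sb; pose b' : d.-tuple V := Tuple sb'.
pose T (c c' : d.-tuple V) v := \sum_i coord c i v *: c'`_i.
have Tl c c' : linear (T c c').
  move=> a u v; rewrite scaler_sumr -big_split; apply: eq_bigr => i _ /=.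
  by rewrite linearP scalerDl scalerA.
have TE (c c' : d.-tuple V) (i : 'I_d) : basis_of fullv c -> T c c' c`_i = c'`_i.
  move=> bc; rewrite /T (bigD1 i) //= big1 => [|j ji].
    by rewrite coord_free ?(basis_free bc) // eqxx scale1r addr0.
  by rewrite coord_free ?(basis_free bc) // eq_sym (negPf ji) scale0r.
have TK (c c' : d.-tuple V) : basis_of fullv c -> basis_of fullv c' ->
    cancel (T c c') (T c' c).
  move=> bc bc' v.
  pose L : {linear V -> V} :=
    HB.pack (T c' c) (GRing.isLinear.Build K V V *:%R _ (Tl c' c)).
  rewrite -[T c' c _]/(L _) linear_sum [in RHS](coord_basis bc (memvf v)).
  by apply: eq_bigr => i _; rewrite linearZ /= TE.
have bi (i : 'I_k) : exists j : 'I_d, b`_j = x i /\ b'`_j = x' i.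
  have ltid : (i < d)%N.
    by rewrite (leq_trans (ltn_ord i)) // -(eqP sb) size_cat size_tuple leq_addr.
  exists (Ordinal ltid).
  rewrite -[b`_ _]/((X ++ Y)`_i) -[b'`_ _]/((X' ++ Y')`_i).
  rewrite !nth_cat (size_tuple X) (size_tuple X') ltn_ord.
  by rewrite -!tnth_nth !tnth_mktuple.
have bf (j : 'I_d) i : f' i b'`_j = f i b`_j.
  rewrite -[b`_ _]/((X ++ Y)`_j) -[b'`_ _]/((X' ++ Y')`_j).
  rewrite !nth_cat (size_tuple X) (size_tuple X'); case: ltnP => [ltjk|lekj].
    by rewrite -[j : nat]/(Ordinal ltjk : nat) -!tnth_nth !tnth_mktuple fx fx'.
  have ltj : (j - k < size Y)%N.
    by rewrite ltn_subLR // -(size_tuple X) -size_cat (eqP sb).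
  have ltj' : (j - k < size Y')%N.
    by rewrite ltn_subLR // -(size_tuple X') -size_cat (eqP sb').
  by rewrite Yf ?Yf' // mem_nth.
exists (T b b'), (T b' b); split; [split|split] => //.
- exact: TK.
- exact: TK.
- by move=> i; have [j [<- <-]] := bi i; apply: TE.
move=> i v; rewrite linear_sum [in RHS](coord_basis (bX : basis_of fullv b) (memvf v)).
by rewrite [in RHS]linear_sum; apply: eq_bigr => j _; rewrite !scalarM bf.
Qed.

End DualSystems.

(** * The five forms and their isomorphism classes *)

Section Forms.
Variables (K : fieldType) (V : vectType K).
Implicit Types (lam mu : algebra V) (f g h : {scalar V}).

(** The algebra e1 e1 = e2. *)
Definition null_form lam := exists f x c,
  [/\ f x = 1, f c = 0, c != 0 & forall u v, lam u v = (f u * f v) *: c].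

(** The algebra J_1. *)
Definition idem_form lam := exists f e,
  f e = 1 /\ forall u v, lam u v = (f u * f v) *: e.

(** The algebra J_2: [e] is the unit and the kernel of [f] has zero multiplication. *)
Definition unit_form lam := exists f e,
  f e = 1 /\ forall u v, lam u v = f u *: v + f v *: u - (f u * f v) *: e.

(** The algebra e1 e1 = e1, e1 ei = ei / 2, which is a Jordan algebra of level one. *)
Definition half_form lam := exists f e,
  f e = 1 /\ forall u v, lam u v = 2^-1 *: (f u *: v + f v *: u).

(** The algebra J_3; [x] and [y] witness the independence of [f] and [g]. *)
Definition hyper_form lam := exists f g x y c,
  ([/\ f x = 1, f y = 0 & f c = 0] /\ [/\ g x = 0, g y = 1 & g c = 0]) /\
  (c != 0 /\ forall u v, lam u v = (f u * g v + g u * f v) *: c).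

Lemma functional_comp f (h : V -> V) :
  linear h -> exists f', forall v, f' v = f (h v).
Proof. by move=> hl; apply: functional_of => a u v; rewrite hl !scalE. Qed.

Lemma functional1_neq0 f x : f x = 1 -> x != 0.
Proof.
by move=> /eqP fx; apply: contraTneq fx => ->; rewrite scalar0 eq_sym oner_eq0.
Qed.

Lemma linear_map0 (h : V -> V) : linear h -> h 0 = 0.
Proof.
by move=> hl; have := hl (-1) 0 0; rewrite !scaleN1r oppr0 addr0 addNr.
Qed.

Lemma can_neq0 (g h : V -> V) c :
  linear g -> linear h -> cancel g h -> c != 0 -> g c != 0.
Proof.
move=> gl hl gK c0; apply/eqP => gc0; case/eqP: c0.
by rewrite -(gK c) gc0 linear_map0.
Qed.

Lemma linear_mapZ (h : V -> V) a x : linear h -> h (a *: x) = a *: h x.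
Proof. by move=> hl; rewrite -[a *: x]addr0 hl linear_map0 // addr0. Qed.

Lemma linear_map_sum (I : Type) (r : seq I) (h : V -> V) (F : I -> V) :
  linear h -> h (\sum_(i <- r) F i) = \sum_(i <- r) h (F i).
Proof.
move=> hl; elim: r => [|i r IH]; first by rewrite !big_nil linear_map0.
by rewrite !big_cons -IH -[in LHS](scale1r (F i)) hl scale1r.
Qed.

Lemma algebra_sumE (I : Type) (r : seq I) (F : I -> algebra V) x y :
  (\sum_(i <- r) F i) x y = \sum_(i <- r) F i x y.
Proof.
elim: r => [|i r IH]; first by rewrite !big_nil !zero_lfunE.
by rewrite !big_cons algebra_addE IH.
Qed.

Lemma alg_suml lam (I : Type) (r : seq I) (F : I -> V) y :
  lam (\sum_(i <- r) F i) y = \sum_(i <- r) lam (F i) y.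
Proof.
by elim: r => [|i r IH]; rewrite ?(big_nil, alg0l) // !big_cons algDl IH.
Qed.

Lemma linear_mapD (h : V -> V) x y : linear h -> h (x + y) = h x + h y.
Proof. by move=> hl; rewrite -[in LHS](scale1r x) hl scale1r. Qed.

Lemma linear_mapN (h : V -> V) x : linear h -> h (- x) = - h x.
Proof. by move=> hl; rewrite -scaleN1r linear_mapZ // scaleN1r. Qed.

Lemma null_form_stable lam mu : Orb lam mu -> null_form lam -> null_form mu.
Proof.
move=> /OrbP[g [h [gl hl gK hK muE]]] [f [x [c [fx fc c0 lamE]]]].
have [f' f'E] := functional_comp f hl.
exists f', (g x), (g c); rewrite !f'E !gK; split=> //.
  exact: can_neq0 gK c0.
by move=> u v; rewrite muE lamE (linear_mapZ _ _ gl) !f'E.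
Qed.

Lemma idem_form_stable lam mu : Orb lam mu -> idem_form lam -> idem_form mu.
Proof.
move=> /OrbP[g [h [gl hl gK hK muE]]] [f [e [fe lamE]]].
have [f' f'E] := functional_comp f hl.
exists f', (g e); rewrite !f'E !gK; split=> // u v.
by rewrite muE lamE (linear_mapZ _ _ gl) !f'E.
Qed.

Lemma unit_form_stable lam mu : Orb lam mu -> unit_form lam -> unit_form mu.
Proof.
move=> /OrbP[g [h [gl hl gK hK muE]]] [f [e [fe lamE]]].
have [f' f'E] := functional_comp f hl.
exists f', (g e); rewrite !f'E !gK; split=> // u v.
by rewrite muE lamE !(linear_mapD _ _ gl, linear_mapN _ gl, linear_mapZ _ _ gl)
  !f'E !hK.
Qed.

Lemma half_form_stable lam mu : Orb lam mu -> half_form lam -> half_form mu.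
Proof.
move=> /OrbP[g [h [gl hl gK hK muE]]] [f [e [fe lamE]]].
have [f' f'E] := functional_comp f hl.
exists f', (g e); rewrite !f'E !gK; split=> // u v.
by rewrite muE lamE !(linear_mapD _ _ gl, linear_mapZ _ _ gl) !f'E !hK.
Qed.

Lemma hyper_form_stable lam mu : Orb lam mu -> hyper_form lam -> hyper_form mu.
Proof.
move=> /OrbP[g [h [gl hl gK hK muE]]].
move=> [f [k [x [y [c [[[fx fy fc] [kx ky kc]] [c0 lamE]]]]]]].
have [f' f'E] := functional_comp f hl.
have [k' k'E] := functional_comp k hl.
exists f', k', (g x), (g y), (g c); rewrite !f'E !k'E !gK; split=> //; split.
  exact: can_neq0 gK c0.
by move=> u v; rewrite muE lamE (linear_mapZ _ _ gl) !f'E !k'E.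
Qed.

Lemma Orb_of_transport lam mu (g h : V -> V) :
  linear g -> linear h -> cancel g h -> cancel h g ->
  (forall u v, mu (g u) (g v) = g (lam u v)) -> Orb lam mu.
Proof.
move=> gl hl gK hK E; apply/OrbP; exists g, h; split=> // x y.
by rewrite -E !hK.
Qed.

Lemma dual_system1 f e : f e = 1 ->
  @dual_system K V 1 (fun=> e) (fun=> f).
Proof. by move=> fe i j; rewrite !ord1 eqxx. Qed.

Lemma dual_system2 f g x y : f x = 1 -> f y = 0 -> g x = 0 -> g y = 1 ->
  dual_system (fun i : 'I_2 => nth 0 [:: x; y] i)
              (fun i : 'I_2 => nth f [:: f; g] i).
Proof. by move=> *; case=> [[|[|//]] ?]; case=> [[|[|//]] ?]. Qed.

Lemma dual_system3 f g h x y z :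
  [/\ f x = 1, f y = 0 & f z = 0] /\ [/\ g x = 0, g y = 1 & g z = 0] ->
  [/\ h x = 0, h y = 0 & h z = 1] ->
  dual_system (fun i : 'I_3 => nth 0 [:: x; y; z] i)
              (fun i : 'I_3 => nth f [:: f; g; h] i).
Proof.
case=> -[? ? ?] [? ? ?]; case=> *.
by case=> [[|[|[|//]]] ?]; case=> [[|[|[|//]]] ?].
Qed.

Lemma idem_form_Orb lam mu : idem_form lam -> idem_form mu -> Orb lam mu.
Proof.
move=> [f [e [fe lamE]]] [f' [e' [fe' muE]]].
have [g [h [[gl hl gK hK] [gx fg]]]] :=
  dual_system_transport (dual_system1 fe) (dual_system1 fe').
apply: (Orb_of_transport gl hl gK hK) => u v.
by rewrite muE lamE (linear_mapZ _ _ gl) (gx ord0) !(fg ord0).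
Qed.

Lemma unit_form_Orb lam mu : unit_form lam -> unit_form mu -> Orb lam mu.
Proof.
move=> [f [e [fe lamE]]] [f' [e' [fe' muE]]].
have [g [h [[gl hl gK hK] [gx fg]]]] :=
  dual_system_transport (dual_system1 fe) (dual_system1 fe').
apply: (Orb_of_transport gl hl gK hK) => u v.
rewrite muE lamE !(linear_mapD _ _ gl, linear_mapN _ gl, linear_mapZ _ _ gl).
by rewrite (gx ord0) !(fg ord0).
Qed.

Lemma half_form_Orb lam mu : half_form lam -> half_form mu -> Orb lam mu.
Proof.
move=> [f [e [fe lamE]]] [f' [e' [fe' muE]]].
have [g [h [[gl hl gK hK] [gx fg]]]] :=
  dual_system_transport (dual_system1 fe) (dual_system1 fe').
apply: (Orb_of_transport gl hl gK hK) => u v.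
by rewrite muE lamE !(linear_mapD _ _ gl, linear_mapZ _ _ gl) !(fg ord0).
Qed.

Lemma null_form_Orb lam mu : null_form lam -> null_form mu -> Orb lam mu.
Proof.
have dual f (x c : V) : f x = 1 -> f c = 0 -> c != 0 ->
    exists h, h x = 0 /\ h c = 1.
  move=> fx fc c0; apply: functional_values2; apply: free2P => [|a E].
    exact: functional1_neq0 fx.
  have := congr1 f E; rewrite fc scalarM fx mulr1 => a0.
  by case/eqP: c0; rewrite E -a0 scale0r.
move=> [f [x [c [fx fc c0 lamE]]]] [f' [x' [c' [fx' fc' c0' muE]]]].
have [k [kx kc]] := dual _ _ _ fx fc c0.
have [k' [kx' kc']] := dual _ _ _ fx' fc' c0'.
have [g [h [[gl hl gK hK] [gx fg]]]] := dual_system_transport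
  (dual_system2 fx fc kx kc) (dual_system2 fx' fc' kx' kc').
apply: (Orb_of_transport gl hl gK hK) => u v.
have /= gc := gx (lift ord0 ord0); have /= ff := fg ord0.
by rewrite muE lamE (linear_mapZ _ _ gl) gc !ff.
Qed.

Lemma hyper_form_Orb lam mu : hyper_form lam -> hyper_form mu -> Orb lam mu.
Proof.
have dual f g (x y c : V) :
    [/\ f x = 1, f y = 0 & f c = 0] /\ [/\ g x = 0, g y = 1 & g c = 0] ->
    c != 0 -> exists h, [/\ h x = 0, h y = 0 & h c = 1].
  case=> -[fx fy fc] [gx gy gc] c0; apply: functional_values3.
  apply: free3P => [|a b E].
    apply: free2P => [|a E].
      exact: functional1_neq0 fx.
    by move/eqP: gy; rewrite E scalarM gx mulr0 eq_sym oner_eq0.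
  have := congr1 f E; rewrite fc !scalE fx fy mulr1 mulr0 addr0 => a0.
  have := congr1 g E; rewrite gc !scalE gx gy mulr1 mulr0 add0r => b0.
  by case/eqP: c0; rewrite E -a0 -b0 !scale0r addr0.
move=> [f1 [f2 [x [y [c [fE [c0 lamE]]]]]]].
move=> [f1' [f2' [x' [y' [c' [fE' [c0' muE]]]]]]].
have [f3 f3E] := dual _ _ _ _ _ fE c0.
have [f3' f3E'] := dual _ _ _ _ _ fE' c0'.
have [g [h [[gl hl gK hK] [gx fg]]]] := dual_system_transport
  (dual_system3 fE f3E) (dual_system3 fE' f3E').
apply: (Orb_of_transport gl hl gK hK) => u v.
have /= gc := gx (lift ord0 (lift ord0 ord0)); have /= ff1 := fg ord0.
have /= ff2 := fg (lift ord0 ord0).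
by rewrite muE lamE (linear_mapZ _ _ gl) gc !ff1 !ff2.
Qed.

End Forms.

(** * Contractions along a weighted splitting *)

Section Contraction.
Variables (K : numFieldType) (V : vectType K).
Implicit Types (lam mu : algebra V) (f : {scalar V}).

(** Let [s] be the projection to the third summand M of V = P(V) + M + K c. The
automorphism acting by [t ^- 2], [t ^- 3], [t ^- 4] on the three summands is
[t ^- 4] times [kt] below, and its inverse is [t ^+ 2] times [ht]; the powers of [t]
then cancel and leave the curve [kt (lam (ht x) (ht y))], polynomial in [t]. *)
Lemma degenerates_projection lam mu f (P : V -> V) c :
  linear P -> (forall x, P (P x) = P x) -> (forall x, f (P x) = 0) ->
  P c = 0 -> f c = 1 ->
  (forall x y, mu x y = f (lam (P x) (P y)) *: c) -> degenerates lam mu.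
Proof.
move=> Pl PP fP Pc fc muE; apply: degenerates_closure.
pose s x := x - P x - f x *: c.
have sl : linear s.
  move=> a u v; rewrite /s Pl !scalE scalerDl -scalerA; apply: functional_ext => k.
  by rewrite !scalE; ring.
pose F x := f x *: c.
have Fl : linear F by move=> a u v; rewrite /F !scalE scalerDl -scalerA.
have PL := (fun x y => linear_mapD x y Pl, fun x => linear_mapN x Pl,
  fun b x => linear_mapZ b x Pl).
have Ps x : P (s x) = 0.
  by rewrite /s !PL Pc PP scaler0 subr0 subrr.
have fs x : f (s x) = 0 by rewrite /s !scalE fP fc; ring.
have ss x : s (s x) = s x by rewrite {1}/s Ps fs scale0r !subr0.
have sP x : s (P x) = 0 by rewrite /s PP fP scale0r !subrr.
have PF x : P (F x) = 0 by rewrite /F !PL Pc scaler0.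
have sF x : s (F x) = 0.
  by rewrite /s PF /F scalarM fc mulr1 subr0 subrr.
have FP x : F (P x) = 0 by rewrite /F fP scale0r.
have Fs x : F (s x) = 0 by rewrite /F fs scale0r.
have FF x : F (F x) = F x by rewrite /F scalarM fc mulr1.
have dec x : P x + s x + F x = x by rewrite /s /F -addrA subrK addrC subrK.
have FfE x : F x = f x *: c by [].
clearbody s F.
pose hh (j : 'I_3) := nth P [:: P; s; F] j.
pose kk (j : 'I_3) := nth P [:: F; s; P] j.
have hhl j : linear (hh j) by case: j => [[|[|[|//]]] ?].
have kkl j : linear (kk j) by case: j => [[|[|[|//]]] ?].
pose u (p : 'I_3 * 'I_3 * 'I_3) : algebra V := bilinear_algebra (fun x y =>
  kk p.1.1 (lam (hh p.1.2 x) (hh p.2 y))).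
have uE p x y : u p x y = kk p.1.1 (lam (hh p.1.2 x) (hh p.2 y)).
  apply: (@bilinear_algebraE K V (fun x y =>
    kk p.1.1 (lam (hh p.1.2 x) (hh p.2 y)))).
    by move=> {}x a v w; rewrite hhl !algE kkl.
  by move=> {}y a v w /=; rewrite hhl !algE kkl.
apply: (@closure_curve _ _ _ _
  (fun p : 'I_3 * 'I_3 * 'I_3 => p.1.1 + p.1.2 + p.2)%N u).
- by move=> m /eqP; rewrite pnatr_eq0 => /eqP.
- move=> t t0.
  pose ht x := P x + t *: s x + t ^+ 2 *: F x.
  pose kt x := F x + t *: s x + t ^+ 2 *: P x.
  have htE x : ht x = \sum_(j < 3) t ^+ j *: hh j x.
    by rewrite !big_ord_recl big_ord0 /= addr0 addrA scale1r.
  have ktE x : kt x = \sum_(j < 3) t ^+ j *: kk j x.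
    by rewrite !big_ord_recl big_ord0 /= addr0 addrA scale1r.
  have htl : linear ht.
    move=> a v w; rewrite /ht Pl sl Fl; apply: functional_ext => k.
    by rewrite !scalE; ring.
  have ktl : linear kt.
    move=> a v w; rewrite /kt Pl sl Fl; apply: functional_ext => k.
    by rewrite !scalE; ring.
  have sL := (fun x y => linear_mapD x y sl, fun b x => linear_mapZ b x sl).
  have FL := (fun x y => linear_mapD x y Fl, fun b x => linear_mapZ b x Fl).
  have kh x : kt (ht x) = t ^+ 2 *: x.
    rewrite /kt /ht !PL !sL !FL !(Ps, PF, ss, sP, sF, FP, Fs, FF, PP).
    rewrite !scaler0 !addr0 !add0r -[in RHS](dec x) !scalerDr scalerA -expr2.
    by rewrite addrC [X in _ + X]addrC addrA.
  have hk x : ht (kt x) = t ^+ 2 *: x.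
    rewrite /kt /ht !PL !sL !FL !(Ps, PF, ss, sP, sF, FP, Fs, FF, PP).
    rewrite !scaler0 !addr0 !add0r -[in RHS](dec x) !scalerDr scalerA -expr2.
    by [].
  apply/OrbP; exists (fun x => t ^- 4 *: kt x), (fun x => t ^+ 2 *: ht x); split.
  + move=> a v w; rewrite ktl; apply: functional_ext => k.
    by rewrite !scalE; ring.
  + move=> a v w; rewrite htl; apply: functional_ext => k.
    by rewrite !scalE; ring.
  + move=> x; rewrite (linear_mapZ _ _ htl) hk !scalerA.
    by rewrite mulrAC -exprD mulfV ?scale1r // expf_neq0.
  + move=> x; rewrite (linear_mapZ _ _ ktl) kh !scalerA.
    by rewrite -[RHS]scale1r; congr (_ *: _); field.
  move=> x y.
  have -> : t ^- 4 *: kt (lam (t ^+ 2 *: ht x) (t ^+ 2 *: ht y)) =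
      kt (lam (ht x) (ht y)).
    rewrite algZl algZr !(linear_mapZ _ _ ktl) !scalerA.
    by rewrite -[RHS]scale1r; congr (_ *: _); field.
  rewrite algebra_sumE ktE -(pair_bigA _
    (fun (ij : 'I_3 * 'I_3) (k : 'I_3) => (t ^+ (ij.1 + ij.2 + k) *: u (ij, k)) x y)) /=.
  rewrite -(pair_bigA _ (fun i j : 'I_3 => \sum_(k < 3)
    (t ^+ (i + j + k) *: u ((i, j), k)) x y)) /=.
  apply: eq_bigr => i _.
  rewrite !htE alg_suml (linear_map_sum _ _ (kkl i)) scaler_sumr.
  apply: eq_bigr => j _; rewrite (linear_sum (lam _)).
  rewrite (linear_map_sum _ _ (kkl i)) scaler_sumr.
  apply: eq_bigr => k _; rewrite algebra_scaleE uE /= !algE.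
  by rewrite !(linear_mapZ _ _ (kkl i)) !scalerA !exprD.
rewrite (big_pred1 ((ord0, ord0), ord0)) => [|[[i j] k] /=].
  by apply: algebra_ext => x y; rewrite muE uE -FfE.
by rewrite !addn_eq0.
Qed.

End Contraction.

Section Criteria.
Variables (K : numClosedFieldType) (V : vectType K).
Implicit Types (lam mu : algebra V) (f : {scalar V}).

Definition commutative_algebra lam := forall x y, lam x y = lam y x.

Lemma degenerates_zero lam f e : f e = 1 -> degenerates lam 0.
Proof.
move=> fe; apply: (@degenerates_projection K V lam 0 f (fun=> 0) e) => //.
- by move=> a u v; rewrite scaler0 addr0.
- by move=> x; rewrite scalar0.
by move=> x y; rewrite !zero_lfunE algE scalar0 scale0r.
Qed.

(** Contract along the line of [x], with [c = x x]. *)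
Lemma degenerates_null_form lam x : (forall a, lam x x <> a *: x) ->
  exists mu, null_form mu /\ degenerates lam mu.
Proof.
move=> hx.
have x0 : x != 0.
  by apply/eqP => x0; case: (hx 0); rewrite x0 algE scaler0.
have fr := free2P x0 hx.
have [k [kx kc]] := functional_values2 1 0 fr.
have [f [fx fc]] := functional_values2 0 1 fr.
set c := lam x x in kc fc.
pose m u v := (k u * k v) *: c.
have mE : forall u v, bilinear_algebra m u v = (k u * k v) *: c.
  apply: (bilinear_algebraE (m := m)) => w a u v; rewrite /m !scalE;
    apply: functional_ext => h; rewrite !scalE; ring.
exists (bilinear_algebra m); split.
  exists k, x, c; split=> //; apply/eqP => c0.
  by move/eqP: fc; rewrite c0 scalar0 eq_sym oner_eq0.
apply: (@degenerates_projection K V lam _ f (fun v => k v *: x) c) => //.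
- by move=> a u v; rewrite !scalE scalerDl scalerA.
- by move=> u; rewrite !scalE kx mulr1.
- by move=> u; rewrite !scalE fx mulr0.
- by rewrite kc scale0r.
by move=> u v; rewrite mE !algE !scalE fc mulr1.
Qed.

(** The binary quadratic form f(zz) on the span of [x] and [y] is non-degenerate, hence
hyperbolic over an algebraically closed field. *)
Lemma hyperbolic_pair lam f x y : commutative_algebra lam ->
  f x = 0 -> f y = 0 -> f (lam x y) ^+ 2 <> f (lam x x) * f (lam y y) ->
  exists x' y', [/\ f x' = 0, f y' = 0, f (lam x' x') = 0, f (lam y' y') = 0
                  & f (lam x' y') = 1].
Proof.
move=> lamC.
suff iso x' y' : f x' = 0 -> f y' = 0 -> f (lam x' x') = 0 ->
    f (lam x' y') != 0 ->
  exists x' y', [/\ f x' = 0, f y' = 0, f (lam x' x') = 0, f (lam y' y') = 0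
                  & f (lam x' y') = 1].
  move=> fx fy hq; have [xx0|xx0] := eqVneq (f (lam x x)) 0.
    apply: (iso x y) => //; apply/eqP => xy0; apply: hq.
    by rewrite xx0 xy0 mul0r expr0n.
  pose a := f (lam x x); pose b := f (lam x y); pose d := f (lam y y).
  pose r := sqrtC (b ^+ 2 - a * d); have rE : r ^+ 2 = b ^+ 2 - a * d := sqrtCK _.
  have r0 : r != 0.
    apply/eqP => r0; apply: hq; apply: subr0_eq.
    by rewrite -/a -/b -/d -rE r0 expr0n.
  (* y + k x is isotropic: k is a root of a k^2 + 2 b k + d. *)
  pose k := (r - b) / a.
  have ak : a * k = r - b by rewrite /k mulrCA mulfV // mulr1.
  apply: (iso (y + k *: x) x) => //.
  - by rewrite !scalE fx fy mulr0 addr0.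
  - rewrite !algE !scalE (lamC y x) -/a -/b -/d.
    apply: (mulfI xx0); rewrite -/a mulr0.
    transitivity ((a * k) ^+ 2 + 2 * b * (a * k) + a * d); first by ring.
    rewrite ak; have -> : a * d = b ^+ 2 - r ^+ 2 by rewrite rE; ring.
    by ring.
  rewrite !algE !scalE (lamC y x) -/a -/b.
  by rewrite mulrC ak addrC subrK.
move=> fx fy xx0 xy0.
pose m := f (lam x' y').
exists x', (m^-1 *: (y' - (f (lam y' y') / (2 * m)) *: x')); split=> //.
- by rewrite !scalE fx fy; ring.
- rewrite !algE !scalE xx0 (lamC y' x') -/m.
  by field; rewrite xy0.
by rewrite !algE !scalE xx0 -/m; field.
Qed.

(** Contract along the plane of a hyperbolic pair, with [c] its product. *)
Lemma degenerates_hyper_form lam f x y : commutative_algebra lam ->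
  f x = 0 -> f y = 0 -> f (lam x y) ^+ 2 <> f (lam x x) * f (lam y y) ->
  exists mu, hyper_form mu /\ degenerates lam mu.
Proof.
move=> lamC fx0 fy0 /(hyperbolic_pair lamC fx0 fy0).
move=> {x y fx0 fy0} [x [y [fx fy fxx fyy fxy]]].
pose c := lam x y.
have x0 : x != 0.
  apply/eqP => x0; move/eqP: fxy.
  by rewrite x0 algE scalar0 eq_sym oner_eq0.
have fr : free [:: x; y; c].
  apply: free3P => [|a b E]; last first.
    move/eqP: fxy; rewrite -/c E !scalE fx fy !mulr0 addr0.
    by rewrite eq_sym oner_eq0.
  apply: free2P => // a E; move/eqP: fxy.
  by rewrite E algE scalE fxx mulr0 eq_sym oner_eq0.
have [k [kx ky kc]] := functional_values3 1 0 0 fr.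
have [h [hx hy hc]] := functional_values3 0 1 0 fr.
pose m u v := (k u * h v + h u * k v) *: c.
have mE : forall u v, bilinear_algebra m u v = (k u * h v + h u * k v) *: c.
  apply: (bilinear_algebraE (m := m)) => w a u v; rewrite /m !scalE;
    apply: functional_ext => g; rewrite !scalE; ring.
exists (bilinear_algebra m); split.
  exists k, h, x, y, c; split=> //; split=> //; apply/eqP => c0.
  by move/eqP: fxy; rewrite -/c c0 scalar0 eq_sym oner_eq0.
apply: (@degenerates_projection K V lam _ f (fun v => k v *: x + h v *: y) c) => //.
- move=> a u v; apply: functional_ext => g; rewrite !scalE; ring.
- by move=> u; rewrite !scalE kx ky hx hy; apply: functional_ext => g;
    rewrite !scalE; ring.
- by move=> u; rewrite !scalE fx fy; ring.
- by rewrite kc hc !scale0r addr0.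
move=> u v; rewrite mE !algE !scalE fxx fyy (lamC y x) fxy.
by congr (_ *: _); ring.
Qed.

End Criteria.

(** * Linear combinations of equations and general position *)

Lemma sub_eq0 (R : zmodType) (l r : R) : l = r -> l - r = 0.
Proof. by move=> ->; rewrite subrr. Qed.

(* [lincombN c1 E1 .. cN EN] proves an equation in a field as the linear
   combination of the equations Ei with coefficients ci. *)
Tactic Notation "lincomb1" uconstr(c1) constr(E1) := apply: subr0_eq;
  match type of E1 with ?l1 = ?r1 =>
    transitivity (c1 * (l1 - r1));
    [first [by ring | by field] | by rewrite (sub_eq0 E1) !mulr0]
  end.

Tactic Notation "lincomb2" uconstr(c1) constr(E1) uconstr(c2) constr(E2) :=
  apply: subr0_eq;
  match type of E1 with ?l1 = ?r1 =>
  match type of E2 with ?l2 = ?r2 =>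
    transitivity (c1 * (l1 - r1) + c2 * (l2 - r2));
    [by ring | by rewrite (sub_eq0 E1) (sub_eq0 E2) !mulr0 !addr0]
  end end.

Tactic Notation "lincomb3" uconstr(c1) constr(E1) uconstr(c2) constr(E2)
    uconstr(c3) constr(E3) := apply: subr0_eq;
  match type of E1 with ?l1 = ?r1 =>
  match type of E2 with ?l2 = ?r2 =>
  match type of E3 with ?l3 = ?r3 =>
    transitivity (c1 * (l1 - r1) + c2 * (l2 - r2) + c3 * (l3 - r3));
    [by ring | by rewrite (sub_eq0 E1) (sub_eq0 E2) (sub_eq0 E3) !mulr0 !addr0]
  end end end.

Lemma exists_notin_plane (K : fieldType) (V : vectType K) (x y : V) :
  (2 < \dim {:V})%N -> exists z, forall a b, z <> a *: x + b *: y.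
Proof.
move=> dV; apply: NNPP => hn.
have : (\dim {:V} <= 2)%N.
  rewrite (leq_trans _ (dim_span [:: x; y])) // dimvS //.
  apply/subvP => z _; case: (boolP (z \in <<[:: x; y]>>%VS)) => // hz.
  case: hn; exists z => a b zE; case/negP: hz.
  by rewrite zE memvD // memvZ // memv_span // !inE eqxx ?orbT.
by rewrite leqNgt dV.
Qed.

Lemma exists_notin_line (K : fieldType) (V : vectType K) (x : V) :
  (2 < \dim {:V})%N -> exists z, forall a, z <> a *: x.
Proof.
move=> /(exists_notin_plane x 0)[z hz]; exists z => a zE; case: (hz a 0).
by rewrite scaler0 addr0.
Qed.

(** If two independent values occurred with different ratios, their sum would have no
ratio at all. For [P = id] this says that a linear map for which every vector is an
eigenvector is scalar. *)
Lemma pointwise_proportional (K : fieldType) (V : vectType K) (M P : V -> V) :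
  linear M -> linear P -> (forall y, exists a, M y = a *: P y) ->
  exists r, forall y, M y = r *: P y.
Proof.
move=> Ml Pl h.
have [[y0 y00]|P0] := classic (exists y, P y != 0); last first.
  exists 0 => y; have [a ->] := h y.
  have [->|Py] := eqVneq (P y) 0; first by rewrite !scaler0.
  by case: P0; exists y.
have [r rE] := h y0; exists r => y.
have [[k kE]|nk] := classic (exists k, P y = k *: P y0).
  have [a] := h (y + (- k) *: y0).
  rewrite !(linear_mapD _ _ Ml, linear_mapD _ _ Pl).
  rewrite !(linear_mapZ _ _ Ml, linear_mapZ _ _ Pl) kE -scalerDl subrr scale0r scaler0.
  by rewrite scaleNr rE => /subr0_eq ->; rewrite !scalerA mulrC.
have [a aE] := h y; have [b] := h (y + y0).
rewrite (linear_mapD _ _ Ml) (linear_mapD _ _ Pl) aE rE => E.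
have fr : free [:: P y0; P y] by apply: free2P => // k E'; apply: nk; exists k.
have [f [f0 f1]] := functional_values2 0 1 fr.
have [g [g0 g1]] := functional_values2 1 0 fr.
have := congr1 f E; rewrite !scalE f0 f1 !(mulr0, mulr1, addr0, add0r) => ->.
by have := congr1 g E; rewrite !scalE g0 g1 !(mulr0, mulr1, addr0, add0r) => ->.
Qed.

(** * Jordan algebras without a hyperbolic degeneration *)

Section Classification.
Variables (K : numClosedFieldType) (V : vectType K).
Variable lam : algebra V.
Hypothesis dV : (2 < \dim {:V})%N.
Hypothesis jlam : jordan lam.

Let mC x y : lam x y = lam y x. Proof. by case: jlam. Qed.

Let two0 : 2%:R != 0 :> K. Proof. by rewrite pnatr_eq0. Qed.

(** The part linear in [z] of the Jordan identity at [x + z]; the part of odd degree is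
isolated by comparing [x + z] with [x - z]. *)
Lemma jordan_linearized x y z :
  lam (lam z y) (lam x x) + 2 *: lam (lam x y) (lam x z) =
  lam z (lam y (lam x x)) + 2 *: lam x (lam y (lam x z)).
Proof.
case: jlam => _; move: mC (algDl lam) (algDr lam) (algNl lam) (algNr lam).
move: (fun u v => lam u v) => m C Dl Dr Nl Nr J.
have J1 := J (x + z) y; have J2 := J (x - z) y; have J3 := J z y.
move: J1 J2; rewrite !(Dl, Dr, Nl, Nr) (C z x) => J1 J2.
apply: functional_ext => f.
move: (congr1 f J1) (congr1 f J2) (congr1 f J3).
rewrite !(scalarD f, scalarN f, scalarM f) => E1 E2 E3.
apply: (mulfI two0).
lincomb3 1 E1 (-1) E2 (-2) E3.
Qed.

Lemma jordan_pow4 x : lam (lam x x) (lam x x) = lam x (lam x (lam x x)).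
Proof. by case: jlam => _; apply. Qed.

(** This negates the criterion of [degenerates_hyper_form]: for every [f], the quadratic
form f(xx) has rank at most one on the kernel of [f]. *)
Definition low_rank := forall (f : {scalar V}) x y, f x = 0 -> f y = 0 ->
  f (lam x y) ^+ 2 = f (lam x x) * f (lam y y).

Hypothesis lr : low_rank.

(** A functional that vanishes at [x] and [y] vanishes at [x x], hence at [x y] by the rank
condition. *)
Lemma low_rank_mul x y : (exists a b, lam x x = a *: x + b *: y) ->
  exists a b, lam x y = a *: x + b *: y.
Proof.
move=> [a [b xxE]]; apply: functional_span2 => f fx fy; apply/eqP.
by rewrite -sqrf_eq0 lr // xxE !scalE fx fy !mulr0 addr0 mul0r.
Qed.

Lemma low_rank_cube x :
  exists a b, lam x (lam x x) = a *: x + b *: lam x x.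
Proof.
by apply: low_rank_mul; exists 0, 1; rewrite scale0r add0r scale1r.
Qed.

(** The eigenvalues of multiplication by an idempotent are among 0, 1/2 and 1. *)
Lemma idempotent_cubic e y : lam e e = e ->
  2 *: lam e (lam e (lam e y)) = 3 *: lam e (lam e y) - lam e y.
Proof.
move=> ee; have := jordan_linearized e e y; rewrite !ee (mC y e) (mC (lam e y) e).
move=> E; apply: functional_ext => f; have := congr1 f E; rewrite !scalE => E'.
lincomb1 (-1) E'.
Qed.

(** As [e e] is a multiple of [e], [low_rank_mul] makes every vector an eigenvector of
multiplication by [e] modulo [e], hence this multiplication is a scalar [r] there.
The cubic equation restricts [r], and forces [p] to vanish when [r = 1]. *)
Lemma idempotent_scalar e : lam e e = e -> e != 0 ->
  exists r (p : {scalar V}), [/\ forall y, lam e y = r *: y + p y *: e,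
    p e = 1 - r, r = 0 \/ r = 2^-1 \/ r = 1 & r = 1 -> forall y, p y = 0].
Proof.
move=> ee e0.
have [h he] := functional_values1 1 e0.
pose P y := y - h y *: e.
have Pl : linear P.
  by move=> a u v; apply: functional_ext => f; rewrite /P !scalE; ring.
pose M y := lam e (P y) - h (lam e (P y)) *: e.
have Ml : linear M.
  move=> a u v; apply: functional_ext => f.
  by rewrite /M /P !algE !scalE; ring.
have [r rE] : exists r, forall y, M y = r *: P y.
  apply: pointwise_proportional => // y.
  have [a [b E]] : exists a b, lam e (P y) = a *: e + b *: P y.
    by apply: low_rank_mul; exists 1, 0; rewrite ee scale1r scale0r addr0.
  exists b; rewrite /M E; apply: functional_ext => f.
  by rewrite /P !scalE he; ring.
have [p pE] : exists p : {scalar V}, forall y, p y = h (lam e y) - r * h y.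
  by apply: functional_of => a u v; rewrite !algE !scalE; ring.
have eE y : lam e y = r *: y + p y *: e.
  have := rE y; rewrite /M /P !algE ee => E; apply: functional_ext => f.
  have := congr1 f E; rewrite pE !scalE he => E'.
  lincomb1 1 E'.
have pe : p e = 1 - r by rewrite pE ee he mulr1.
have cubic y : (2 * r ^+ 3 - 3 * r ^+ 2 + r) *: y
    + ((2 * r ^+ 2 - r) * p y) *: e = 0.
  have := idempotent_cubic y ee; rewrite !eE !scalE pe => E; apply: functional_ext => f.
  have := congr1 f E; rewrite !scalE => E'.
  lincomb1 1 E'.
have [y hy] := exists_notin_line e dV.
have fr := free2P e0 hy.
have [f [fe fy]] := functional_values2 0 1 fr.
have r3 : 2 * r ^+ 3 - 3 * r ^+ 2 + r = 0.
  by have := congr1 f (cubic y); rewrite !scalE fe fy mulr1 mulr0 addr0.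
exists r, p; split=> // [|r1 z].
  have : r * ((2 * r - 1) * (r - 1)) = 0 by rewrite -r3; ring.
  move/eqP; rewrite !mulf_eq0 => /orP[/eqP->|/orP[/eqP r2|]].
  - by left.
  - right; left; apply: (mulfI two0); rewrite mulfV //.
    by apply: subr0_eq.
  by rewrite subr_eq0 => /eqP->; right; right.
have := congr1 h (cubic z); rewrite !scalE r3 mul0r add0r he mulr1 r1.
by move=> <-; ring.
Qed.

(** The case A = K e + A_0. Test the rank condition on functionals that agree with a fixed
[psi] on A_0 = ker p and take a variable value [s] on [e], at the vectors
[e - s *: y] and [w]; comparing [s = 1] and [s = -1] gives y w in K w for all y, w in
A_0, hence y w = 0 for independent y and w, and then for all. *)
Lemma idem_form_of_idempotent e (p : {scalar V}) : lam e e = e -> p e = 1 ->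
  (forall y, lam e y = p y *: e) -> idem_form lam.
Proof.
move=> ee pe eE.
(* The Peirce rule A_0 A_0 <= A_0. *)
have pH y z : p y = 0 -> p z = 0 -> p (lam y z) = 0.
  move=> py pz; have := congr1 p (jordan_linearized e z y).
  rewrite !ee (mC z e) (mC (lam y z) e) !eE py pz !scale0r !algE.
  by rewrite !scalE pe mulr1 !(mulr0, mul0r, addr0).
have key (psi : {scalar V}) y w s : psi e = 0 -> p y = 0 -> p w = 0 ->
    psi y = 1 -> psi w = 0 ->
    s ^+ 2 * psi (lam y w) ^+ 2 =
    (s + s ^+ 2 * psi (lam y y)) * psi (lam w w).
  move=> psie py pw psiy psiw.
  have [f fE] : exists f : {scalar V}, forall v, f v = psi v + s * p v.
    by apply: functional_of => a u v; rewrite !scalE; ring.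
  pose x := e - s *: y.
  have fx : f x = 0 by rewrite fE !scalE psie pe py psiy; ring.
  have fw : f w = 0 by rewrite fE psiw pw; ring.
  have fxw : f (lam x w) = - s * psi (lam y w).
    by rewrite /x !algE eE pw scale0r add0r fE !scalE pH //; ring.
  have fxx : f (lam x x) = s + s ^+ 2 * psi (lam y y).
    rewrite /x !algE ee (mC y e) !eE py scale0r fE !(scalE, scaler0).
    by rewrite psie pe pH //; ring.
  have fww : f (lam w w) = psi (lam w w) by rewrite fE pH // mulr0 addr0.
  by have := lr fx fw; rewrite fxw fxx fww => <-; ring.
have key2 (psi : {scalar V}) y w : psi e = 0 -> p y = 0 -> p w = 0 ->
    psi y = 1 -> psi w = 0 -> psi (lam w w) = 0 /\ psi (lam y w) = 0.
  move=> psie py pw psiy psiw.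
  have E1 := key psi y w 1 psie py pw psiy psiw.
  have E2 := key psi y w (-1) psie py pw psiy psiw.
  have w0 : psi (lam w w) = 0.
    by apply: (mulfI two0); rewrite mulr0; lincomb2 (-1) E1 1 E2.
  split=> //; apply/eqP; rewrite -sqrf_eq0; apply/eqP.
  by move: E1; rewrite w0 mulr0 expr1n mul1r.
have lamH y w : p y = 0 -> p w = 0 -> exists a, lam y w = a *: w.
  move=> py pw; apply: functional_span1 => f fw.
  have [psi psiE] : exists psi : {scalar V}, forall v, psi v = f v - f e * p v.
    by apply: functional_of => a u v; rewrite !scalE; ring.
  have psie : psi e = 0 by rewrite psiE pe mulr1 subrr.
  have psiw : psi w = 0 by rewrite psiE pw mulr0 subr0.
  suff : psi (lam y w) = 0 by rewrite psiE pH // mulr0 subr0.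
  have [h0|h1] := classic (forall v, p v = 0 -> psi v = 0); first by rewrite h0 ?pH.
  have [v [pv psiv]] : exists v, p v = 0 /\ psi v != 0.
    apply: NNPP => hn; apply: h1 => v pv; apply/eqP/negPn/negP => psiv.
    by apply: hn; exists v.
  have [v' [pv' psiv']] : exists v', p v' = 0 /\ psi v' = 1.
    by exists ((psi v)^-1 *: v); rewrite !scalE pv mulr0 mulVf.
  pose y' := y + (1 - psi y) *: v'.
  have py' : p y' = 0 by rewrite !scalE py pv' mulr0 addr0.
  have psiy' : psi y' = 1 by rewrite !scalE psiv'; ring.
  have [_ E1] := key2 _ _ _ psie pv' pw psiv' psiw.
  have [_ E2] := key2 _ _ _ psie py' pw psiy' psiw.
  by move: E2; rewrite !algE !scalE E1 mulr0 addr0.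
have H0 y w : p y = 0 -> p w = 0 -> (forall a, y <> a *: w) -> lam y w = 0.
  move=> py pw yw; have [a aE] := lamH y w py pw; have [b bE] := lamH w y pw py.
  have [->|w0] := eqVneq w 0; first by rewrite algE.
  have [f [fw fy]] := functional_values2 1 0 (free2P w0 yw).
  have a0 : a = 0.
    have := congr1 f aE; rewrite (mC y w) bE !scalE fw fy mulr1 mulr0 => <- //.
  by rewrite aE a0 scale0r.
have HH y w : p y = 0 -> p w = 0 -> lam y w = 0.
  move=> py pw; have [[a aE]|na] := classic (exists a, y = a *: w); last first.
    by apply: H0 => // a yw; apply: na; exists a.
  suff ww : lam w w = 0 by rewrite aE algE ww scaler0.
  have [z0 hz0] := exists_notin_plane e w dV; pose z := z0 - p z0 *: e.
  have pz : p z = 0 by rewrite !scalE pe mulr1 subrr.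
  have zw b : z <> b *: w.
    move=> zE; apply: (hz0 (p z0) b); rewrite -zE /z addrC subrK //.
  have [->|w0] := eqVneq w 0; first by rewrite algE.
  have zww b : z + w <> b *: w.
    by move=> E; apply: (zw (b - 1)); rewrite scalerBl -E scale1r addrK.
  have := H0 (z + w) w; rewrite algE H0 // add0r; apply=> //.
  by rewrite scalE pz pw addr0.
exists p, e; split=> // u v.
have pq x : p (x - p x *: e) = 0 by rewrite !scalE pe mulr1 subrr.
have := HH _ _ (pq u) (pq v).
rewrite !algE ee (mC u e) !eE => E; apply: functional_ext => f.
have := congr1 f E; rewrite !scalE => E'.
lincomb1 1 E'.
Qed.

(** The case A = K e + A_{1/2}. The Peirce rules put y y in A_0 + A_1 = K e for y in
A_{1/2}; if y y = q e, comparing (y y)(y y) = q^2 e with y (y (y y)) = q^2 e / 2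
yields q = 0. *)
Lemma half_form_of_idempotent e (p : {scalar V}) :
  lam e e = e -> p e = 2^-1 ->
  (forall y, lam e y = 2^-1 *: y + p y *: e) -> half_form lam.
Proof.
move=> ee pe eE.
have sq y : p y = 0 -> lam y y = 0.
  move=> py.
  have ey : lam e y = 2^-1 *: y by rewrite eE py scale0r addr0.
  have [q yy] : exists q, lam y y = q *: e.
    exists (2 * p (lam y y)).
    have := jordan_linearized y e e; rewrite ee (mC y e) !ey !algE !ey !algE.
    rewrite !eE => E; apply: functional_ext => f.
    have := congr1 f E; rewrite !scalE pe => E'.
    lincomb1 4 E'.
  have := jordan_pow4 y; rewrite yy !algE ee (mC y e) ey !algE yy => E.
  have e0 : e != 0.
    apply/eqP => e0; move/eqP: pe.
    by rewrite e0 scalar0 eq_sym invr_eq0 (negPf two0).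
  have [f fe] := functional_values1 1 e0.
  have := congr1 f E; rewrite !scalE fe => E'.
  suff -> : q = 0 by rewrite scale0r.
  apply/eqP; rewrite -sqrf_eq0; apply/eqP; lincomb1 2 E'.
have prod y z : p y = 0 -> p z = 0 -> lam y z = 0.
  move=> py pz; have := sq (y + z); rewrite !algE !sq // (mC z y) scalE py pz.
  rewrite addr0 add0r addr0 => /(_ erefl) E.
  by apply: (scalerI two0); rewrite scaler0 scaler_nat.
have [f fE] : exists f : {scalar V}, forall v, f v = 2 * p v.
  by apply: functional_of => a u v; rewrite !scalE; ring.
have fe : f e = 1 by rewrite fE pe mulfV.
exists f, e; split=> // u v.
have pq x : p (x - f x *: e) = 0 by rewrite !scalE fE pe; field.
have := prod _ _ (pq u) (pq v).
rewrite !algE ee (mC u e) !eE => E; apply: functional_ext => h.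
have := congr1 h E; rewrite !scalE !fE => E'.
lincomb1 1 E'.
Qed.

(* The case where the idempotent e is a unit. *)
Section Unit.
Variable e : V.
Hypothesis e0 : e != 0.
Hypothesis eE : forall y, lam e y = y.

Let Ee y : lam y e = y. Proof. by rewrite mC eE. Qed.

(** Otherwise e, w, w w are independent and w satisfies a monic cubic equation, and so
does w + s e; by [low_rank_cube] both equations have no constant term. A cubic
polynomial cannot vanish at every [- s]. *)
Lemma unit_quadratic w : exists t l, lam w w = t *: w + l *: e.
Proof.
have [[k ->]|nk] := classic (exists k, w = k *: e).
  by exists k, 0; rewrite !algE eE scale0r addr0.
apply: NNPP => hn.
have fr : free [:: e; w; lam w w].
  apply: free3P => [|l t E].
    by apply: free2P => // k E; apply: nk; exists k.
  by apply: hn; exists t, l; rewrite addrC.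
have [a [b E]] := low_rank_cube w.
have key s : s ^+ 3 + b * s ^+ 2 - a * s = 0.
  have [f [fe fw fww]] := functional_values3 1 (- s) (s ^+ 2) fr.
  pose x := w + s *: e.
  have fx : f x = 0 by rewrite !scalE fe fw; ring.
  have xx : lam x x = lam w w + (2 * s) *: w + s ^+ 2 *: e.
    by apply: functional_ext => g; rewrite /x !algE !eE !Ee !(scalE g); ring.
  have fxx : f (lam x x) = 0 by rewrite xx !scalE fe fw fww; ring.
  have := lr fx fxx; rewrite fxx mul0r => /eqP; rewrite sqrf_eq0 => /eqP <-.
  by rewrite xx /x !algE !eE !Ee E !(scalE f) fe fw fww; ring.
have := key 1; have := key (-1); have := key 2 => E3 E2 E1.
suff : 6%:R = 0 :> K by apply/eqP; rewrite pnatr_eq0.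
lincomb3 (-3) E1 (-1) E2 1 E3.
Qed.

(** Otherwise, after rescaling, v v = e and p = (e + v) / 2 is an idempotent with
p (e - p) = 0. So p falls in the case A = K p + A_0 and A_0 has zero multiplication,
while e - p is an idempotent in A_0. *)
Lemma unit_nilpotent v m : lam v v = m *: e -> (forall k, v <> k *: e) ->
  lam v v = 0.
Proof.
move=> vv ve; have [m0|m0] := eqVneq m 0; first by rewrite vv m0 scale0r.
pose s := sqrtC m; have s2 : s ^+ 2 = m := sqrtCK m.
have s0 : s != 0 by rewrite -sqrf_eq0 s2.
have [p pE] : exists p, p = 2^-1 *: (e + s^-1 *: v) by eexists.
have vE : v = s *: (2 *: p - e).
  rewrite pE scalerA mulfV // scale1r [e + _]addrC addrK scalerA mulfV //.
  by rewrite scale1r.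
have pp : lam p p = p.
  rewrite {1 2}pE !algE vv !eE !Ee pE; apply: functional_ext => f.
  by rewrite !(scalE f) -s2; field.
have pe k : p <> k *: e.
  move=> E; apply: (ve (s * (2 * k - 1))); rewrite vE E.
  by apply: functional_ext => f; rewrite !scalE; ring.
have p0 : p != 0 by apply/eqP => p0; apply: (pe 0); rewrite scale0r.
have [r [q [qE qp _ _]]] := idempotent_scalar pp p0.
have [f [fe fp]] := functional_values2 1 0 (free2P e0 pe).
have r0 : r = 0.
  have := qE e; rewrite Ee => /(congr1 f); rewrite !scalE fe fp.
  by rewrite mulr1 mulr0 addr0 => <-.
have [g [c [gc lamE]]] : idem_form lam.
  apply: (idem_form_of_idempotent pp (p := q)).
    by rewrite qp r0 subr0.
  by move=> y; rewrite qE r0 scale0r add0r.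
have eE' : e = (g e * g e) *: c by rewrite -lamE eE.
have pE' : p = (g p * g p) *: c by rewrite -lamE pp.
have ge0 : g e * g e != 0.
  by apply: contraNneq e0 => ge0; rewrite eE' ge0 scale0r.
case: (pe (g p * g p * (g e * g e)^-1)).
have cE : c = (g e * g e)^-1 *: e.
  by apply: (scalerI ge0); rewrite -eE' scalerA mulfV // scale1r.
by rewrite -scalerA -cE -pE'.
Qed.

Lemma unit_nilpotent_shift w : exists t, lam (w - t *: e) (w - t *: e) = 0.
Proof.
have [[k ->]|nk] := classic (exists k, w = k *: e).
  by exists k; rewrite subrr algE.
have [t [l ww]] := unit_quadratic w.
exists (t / 2); apply: (@unit_nilpotent _ (l + (t / 2) ^+ 2)).
  rewrite !algE !eE !Ee ww; apply: functional_ext => f.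
  by rewrite !(scalE f); field.
move=> k E; apply: nk; exists (k + t / 2).
by rewrite scalerDl -E subrK.
Qed.

(** The shifts that make u + v and u - v square to zero produce a linear relation between
u, v and e; multiplying it by u and v shows that it is trivial. *)
Lemma unit_nilpotents_mul u v : lam u u = 0 -> lam v v = 0 -> lam u v = 0.
Proof.
move=> uu vv.
have [t Et] := unit_nilpotent_shift (u + v).
have [t' Et'] := unit_nilpotent_shift (u - v).
move: Et Et'; rewrite !algE (mC v u) !eE !Ee uu vv => Et Et'.
pose a := 2 * (t + t'); pose b := 2 * (t - t'); pose g := t ^+ 2 + t' ^+ 2.
have E : a *: u + b *: v = g *: e.
  apply: functional_ext => f; move: (congr1 f Et) (congr1 f Et').
  rewrite !(scalE f) => E1 E2; rewrite /a /b /g.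
  lincomb2 (-1) E1 (-1) E2.
have Eu : b *: lam u v = g *: u.
  by have := congr1 (lam u) E; rewrite !algE uu Ee scaler0 add0r.
have Ev : a *: lam u v = g *: v.
  by have := congr1 (lam v) E; rewrite !algE vv Ee scaler0 addr0 (mC v u).
have [g0|g0] := eqVneq g 0; last first.
  have uE : u = (b / g) *: lam u v.
    by rewrite mulrC -scalerA Eu scalerA mulVf // scale1r.
  have vE : v = (a / g) *: lam u v.
    by rewrite mulrC -scalerA Ev scalerA mulVf // scale1r.
  have eEuv : e = (2 * a * b / g ^+ 2) *: lam u v.
    have -> : e = g^-1 *: (a *: u + b *: v) by rewrite E scalerA mulVf ?scale1r.
    rewrite {1}uE {2}vE; apply: functional_ext => f.
    by rewrite !(scalE f); field.
  have k0 : 2 * a * b / g ^+ 2 != 0.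
    by apply: contraNneq e0 => k0; rewrite eEuv k0 scale0r.
  have uv : lam u v = (2 * a * b / g ^+ 2)^-1 *: e.
    by rewrite [in RHS]eEuv scalerA mulVf // scale1r.
  move: uE; rewrite uv scalerA; set k := _ * _ => uE.
  move/eqP: uu; rewrite uE !algE eE !scaler_eq0 (negPf e0) orbF orbb => /eqP k00.
  have u0 : u = 0 by rewrite uE k00 scale0r.
  by rewrite -uv u0 algE.
apply/eqP/negPn/negP => uv0; case/eqP: (uv0).
have b0 : b = 0.
  by move/eqP: Eu; rewrite g0 scale0r scaler_eq0 (negPf uv0) orbF => /eqP.
have a0 : a = 0.
  by move/eqP: Ev; rewrite g0 scale0r scaler_eq0 (negPf uv0) orbF => /eqP.
have t0 : t = 0.
  apply: (mulfI (_ : 4%:R != 0)); first by rewrite pnatr_eq0.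
  by rewrite mulr0 -[RHS](addr0 0) -{1}a0 -b0 /a /b; ring.
apply: functional_ext => f; apply: (mulfI two0).
move: (congr1 f Et); rewrite t0 !(scalE f) => E1.
lincomb1 1 E1.
Qed.

(** The square-zero elements form a complement of K e with zero multiplication, and the
functional sought maps w to its shift. *)
Lemma unit_form_of_unit : unit_form lam.
Proof.
have ex w : exists t, lam (w - t *: e) (w - t *: e) == 0.
  by have [t tE] := unit_nilpotent_shift w; exists t; apply/eqP.
pose T w := xchoose (ex w).
have TE w : lam (w - T w *: e) (w - T w *: e) = 0 := eqP (xchooseP (ex w)).
have Tuniq w t : lam (w - t *: e) (w - t *: e) = 0 -> T w = t.
  move=> tE; have := unit_nilpotents_mul (TE w) tE.
  have TwE := TE w; move: (T w) TwE => t' t'E E.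
  have [f fe] := functional_values1 1 e0.
  move: (congr1 f t'E) (congr1 f tE) (congr1 f E).
  rewrite !algE !eE !Ee !(scalE f) fe => E1 E2 E3.
  apply: subr0_eq; apply/eqP; rewrite -sqrf_eq0; apply/eqP.
  lincomb3 1 E1 1 E2 (-2) E3.
have nilp a n m : lam n n = 0 -> lam m m = 0 ->
    lam (a *: n + m) (a *: n + m) = 0.
  move=> nn mm; have nm := unit_nilpotents_mul nn mm.
  by rewrite !algE nn mm (mC m n) nm !scaler0 !addr0.
have [f fE] : exists f : {scalar V}, forall w, f w = T w.
  apply: functional_of => a u v; apply: Tuniq.
  have -> : a *: u + v - (a * T u + T v) *: e =
      a *: (u - T u *: e) + (v - T v *: e).
    by apply: functional_ext => f; rewrite !(scalE f); ring.
  exact: nilp.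
exists f, e; split=> [|u v].
  by rewrite fE; apply: Tuniq; rewrite scale1r subrr algE.
have := unit_nilpotents_mul (TE u) (TE v); rewrite -!fE.
rewrite !algE !eE !Ee => E; apply: functional_ext => g.
have := congr1 g E; rewrite !(scalE g) => E'.
lincomb1 1 E'.
Qed.

End Unit.

(* The case without idempotents. *)
Section Nil.
Hypothesis no_idem : forall e, lam e e = e -> e = 0.

Lemma nil_square y b : lam y y = b *: y -> lam y y = 0.
Proof.
move=> yy; have [b0|b0] := eqVneq b 0; first by rewrite yy b0 scale0r.
have := no_idem (e := b^-1 *: y).
rewrite !algE yy scalerK ?unitfE // => /(_ erefl)/eqP.
by rewrite scaler_eq0 invr_eq0 (negPf b0) /= => /eqP->; rewrite scaler0.
Qed.

(** By [low_rank_cube] the powers of y stay in the span of y and y y, and a non-zero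
coefficient would produce an idempotent there: the unit of this subalgebra if the
coefficient a of y is non-zero, a multiple of y y otherwise. *)
Lemma nil_cube y : lam y (lam y y) = 0.
Proof.
have [a [b E]] := low_rank_cube y.
have E4 : lam (lam y y) (lam y y) = a *: lam y y + b *: (a *: y + b *: lam y y).
  by rewrite jordan_pow4 // E !algE E.
have [a0|a0] := eqVneq a 0.
  have [b0|b0] := eqVneq b 0; first by rewrite E a0 b0 !scale0r addr0.
  have := no_idem (e := b ^- 2 *: lam y y); rewrite !algE E4 a0.
  rewrite !scale0r !add0r !scalerA; have -> : b ^- 2 * b ^- 2 * b * b = b ^- 2 by field.
  move=> /(_ erefl)/eqP; rewrite scaler_eq0 invr_eq0 expf_eq0 (negPf b0) /=.
  by move=> /eqP->; rewrite algE.
have := no_idem (e := a^-1 *: (lam y y - b *: y)).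
have -> : lam (a^-1 *: (lam y y - b *: y)) (a^-1 *: (lam y y - b *: y)) =
    a^-1 *: (lam y y - b *: y).
  rewrite !algE E4 (mC (lam y y) y) !E; apply: functional_ext => f.
  by rewrite !(scalE f); field.
move=> /(_ erefl)/eqP; rewrite scaler_eq0 invr_eq0 (negPf a0) /= => /eqP/subr0_eq.
by move=> /nil_square ->; rewrite algE.
Qed.

Lemma nil_cube_linearized x y : lam x (lam y y) + 2 *: lam y (lam x y) = 0.
Proof.
have E1 := nil_cube (x + y); have E2 := nil_cube (x - y); have E3 := nil_cube x.
move: E1 E2; rewrite !algE (mC y x) => E1 E2; apply: functional_ext => f.
move: (congr1 f E1) (congr1 f E2) (congr1 f E3).
rewrite !(scalE f) => E1' E2' E3'; apply: (mulfI two0).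
lincomb3 1 E1' 1 E2' (-2) E3'.
Qed.

Variable x : V.
Hypothesis c0 : lam x x != 0.
Let c := lam x x.

Let xc : lam x c = 0. Proof. exact: nil_cube. Qed.
Let cc : lam c c = 0. Proof. by rewrite jordan_pow4 // xc algE. Qed.
Let cx a : c <> a *: x.
Proof. by move=> /nil_square xx; case/eqP: c0. Qed.
Let x0 : x != 0.
Proof. by apply: contraNneq c0 => ->; rewrite algE. Qed.

(** Modulo x and y, the rank condition says that (x y)^2 = c (y y) as products of linear
forms, where c = x x; hence x y and y y are k c and k^2 c for some k. *)
Lemma nil_low_rank y : (forall a b, y <> a *: x + b *: c) ->
  exists k p r u v, lam x y = k *: c + p *: x + r *: y /\
    lam y y = k ^+ 2 *: c + u *: x + v *: y.
Proof.
move=> hy; have fr := free3P (free2P x0 cx) hy.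
have [f0 [f0x f0c f0y]] := functional_values3 0 1 0 fr.
have [p [r [k E]]] : exists p r k, lam x y = p *: x + r *: y + k *: c.
  apply: functional_span3 => f fx fy fc; apply/eqP.
  by rewrite -sqrf_eq0 lr // -/c fc mul0r.
have xy0 : f0 (lam x y) = k.
  by rewrite E !scalE f0x f0y f0c; ring.
have yy0 : f0 (lam y y) = k ^+ 2 by rewrite -xy0 lr // -/c f0c mul1r.
have [u [v [m E']]] : exists u v m, lam y y = u *: x + v *: y + m *: c.
  apply: functional_span3 => f fx fy fc.
  have [f1 f1E] : exists f1 : {scalar V}, forall v, f1 v = f0 v + f v.
    by apply: functional_of => a u v; rewrite !scalE; ring.
  have xy1 : f1 (lam x y) = k.
    by rewrite f1E E !scalE f0x f0y f0c fx fy fc; ring.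
  have := lr (f := f1) (x := x) (y := y); rewrite xy1 !f1E f0x f0y fx fy -/c.
  rewrite f0c fc !addr0 yy0 => /(_ erefl erefl) E'.
  lincomb1 (-1) E'.
have mk : m = k ^+ 2 by rewrite -yy0 E' !scalE f0x f0y f0c; ring.
exists k, p, r, u, v; rewrite E E' mk; split; apply: functional_ext => f;
  rewrite !scalE; ring.
Qed.

(** Each linearised cube identity, read along one of the independent vectors x, c, y,
kills one of the coefficients: u, then v, p and r. *)
Lemma nil_kernel_special y p r u v : (forall a b, y <> a *: x + b *: c) ->
  lam x y = p *: x + r *: y -> lam y y = u *: x + v *: y ->
  lam x y = 0 /\ lam y y = 0.
Proof.
move=> hy xy yy.
have fr := free3P (free2P x0 cx) hy.
have [fx [fxx fxc fxy]] := functional_values3 1 0 0 fr.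
have [fc [fcx fcc fcy]] := functional_values3 0 1 0 fr.
have [fy [fyx fyc fyy]] := functional_values3 0 0 1 fr.
have R2 := nil_cube_linearized x y.
have u0 : u = 0.
  move: R2; rewrite yy xy !algE (mC y x) xy yy -/c => /(congr1 fc).
  by rewrite !scalE fcx fcc fcy => <-; ring.
have yy0 : lam y y = 0 by apply: (@nil_square _ v); rewrite yy u0 scale0r add0r.
have p0 : p = 0.
  move: R2; rewrite yy0 xy !algE (mC y x) xy yy0 => /(congr1 fx).
  rewrite !scalE fxx fxy => E; apply/eqP; rewrite -sqrf_eq0; apply/eqP.
  lincomb1 2^-1 E.
have xy' : lam x y = r *: y by rewrite xy p0 scale0r add0r.
have cy : lam c y = (- 2 * r ^+ 2) *: y.
  have := nil_cube_linearized y x; rewrite -/c (mC y x) (mC y c) xy' !algE xy' => E.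
  apply: functional_ext => f; have := congr1 f E; rewrite !scalE => E'.
  lincomb1 1 E'.
have r0 : r = 0.
  have := nil_cube_linearized y c; rewrite cc (mC y c) cy !algE cy => /(congr1 fy).
  rewrite !scalE fyy => E; have r4 : r ^+ 4 = 0 by lincomb1 8^-1 E.
  by move/eqP: r4; rewrite expf_eq0 => /andP[_ /eqP].
by rewrite xy' r0 scale0r.
Qed.

(* The vectors that annihilate x and square to zero turn out to be a hyperplane with
   zero multiplication. *)
Let kernel v := lam x v = 0 /\ lam v v = 0.

Lemma nil_kernel_shift v : exists b, kernel (v - b *: x).
Proof.
have [[a [b ->]]|hv] := classic (exists a b, v = a *: x + b *: c).
  exists a; rewrite addrAC subrr add0r.
  by split; rewrite !algE ?xc ?cc !scaler0.
have [k [p [r [u [w [E E']]]]]] : exists k p r u w,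
    lam x v = k *: c + p *: x + r *: v /\
    lam v v = k ^+ 2 *: c + u *: x + w *: v.
  by apply: nil_low_rank => a b vE; apply: hv; exists a, b.
exists k; apply: (@nil_kernel_special _ (p + r * k) r
    (u - 2 * k * p + (w - 2 * k * r) * k) (w - 2 * k * r)).
- move=> a b vE; apply: hv; exists (a + k), b.
  by rewrite scalerDl addrAC -vE subrK.
- rewrite !algE E -/c; apply: functional_ext => f; rewrite !(scalE f); ring.
rewrite !algE (mC v x) E E' -/c; apply: functional_ext => f; rewrite !(scalE f); ring.
Qed.

(** Every vector is a multiple of x modulo [kernel], which is closed under addition
because x (v + w) = 0 leaves only the multiple 0; polarising, its products vanish. *)
Lemma null_form_of_nil : null_form lam.
Proof.
have shift0 v b : lam x v = 0 -> kernel (v - b *: x) -> b = 0.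
  move=> xv []; rewrite !algE xv -/c add0r => /eqP.
  by rewrite oppr_eq0 scaler_eq0 (negPf c0) orbF => /eqP.
have mul0 v w : kernel v -> kernel w -> lam v w = 0.
  move=> [xv vv] [xw ww].
  have [b kb] := nil_kernel_shift (v + w).
  have b0 : b = 0 by apply: shift0 kb; rewrite algE xv xw addr0.
  move: kb => []; rewrite b0 scale0r subr0 !algE (mC w v) vv ww add0r addr0 => _ E.
  by apply: (scalerI two0); rewrite scaler0 scaler_nat.
have [h hc] := functional_values1 1 c0.
have [f fE] : exists f : {scalar V}, forall v, f v = h (lam x v).
  by apply: functional_of => a u v; rewrite !algE !scalE.
have ker v : kernel (v - f v *: x).
  have [b kb] := nil_kernel_shift v; suff -> : f v = b by [].
  have [xv _] := kb; move: xv; rewrite !algE -/c fE => /subr0_eq ->.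
  by rewrite scalE hc mulr1.
exists f, x, c; split=> [| | |u v].
- by rewrite fE hc.
- by rewrite fE xc scalar0.
- exact: c0.
have := mul0 _ _ (ker u) (ker v); have [xu _] := ker u; have [xv _] := ker v.
move: xu xv; rewrite !algE (mC u x) -/c => /subr0_eq -> /subr0_eq -> E.
apply: functional_ext => g; have := congr1 g E; rewrite !(scalE g) => E'.
lincomb1 1 E'.
Qed.

End Nil.

Theorem low_rank_classification : lam != 0 ->
  [\/ null_form lam, half_form lam, idem_form lam | unit_form lam].
Proof.
move=> lam0.
have [[e [ee e0]]|no] := classic (exists e, lam e e = e /\ e != 0).
  have [r [p [eE pe r3 p0]]] := idempotent_scalar ee e0.
  case: r3 => [r0|[r2|r1]].
  - apply: Or43; apply: (idem_form_of_idempotent ee (p := p)).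
      by rewrite pe r0 subr0.
    by move=> y; rewrite eE r0 scale0r add0r.
  - apply: Or42; apply: (half_form_of_idempotent ee (p := p)).
      by rewrite pe r2; field.
    by move=> y; rewrite eE r2.
  apply: Or44; apply: (unit_form_of_unit e0) => y.
  by rewrite eE r1 p0 // scale1r scale0r addr0.
have no_idem e : lam e e = e -> e = 0.
  move=> ee; apply/eqP/negPn/negP => e0; apply: no; exists e; split=> //.
have [[x x0]|h] := classic (exists x, lam x x != 0).
  by apply: Or41; apply: null_form_of_nil x0.
case/eqP: lam0; apply: algebra_ext => u v; rewrite !zero_lfunE.
have sq y : lam y y = 0 by apply/eqP/negPn/negP => y0; apply: h; exists y.
have := sq (u + v); rewrite !algE !sq (mC v u) add0r addr0 => E.
by apply: (scalerI two0); rewrite scaler0 scaler_nat.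
Qed.

End Classification.

(** * Closed conditions on degenerations *)

Section Closed.
Variables (K : numClosedFieldType) (V : vectType K).
Hypothesis dV : (2 < \dim {:V})%N.
Implicit Types (lam mu nu : algebra V) (f g : {scalar V}).

Lemma degenerates_polyfun lam mu (F : algebra V -> K) :
  polyfun F -> (forall nu, Orb lam nu -> F nu = 0) -> degenerates lam mu ->
  F mu = 0.
Proof. by move=> pF F0 /degenerates_in; apply: closure_polyfun. Qed.

Lemma degenerates_identity lam mu (F G : algebra V -> V) :
  polymap F -> polymap G -> (forall nu, Orb lam nu -> F nu = G nu) ->
  degenerates lam mu -> F mu = G mu.
Proof.
move=> pF pG FG d; apply: functional_ext => f; apply: subr0_eq.
apply: (degenerates_polyfun (F := fun nu => f (F nu) - f (G nu)) _ _ d).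
  by apply: polyfunB; [apply: pF | apply: pG].
by move=> nu /FG ->; rewrite subrr.
Qed.

Lemma jordan_stable lam mu : Orb lam mu -> jordan lam -> jordan mu.
Proof.
move=> /OrbP[g [h [gl hl gK hK muE]]] [C J]; split=> x y; rewrite !muE.
  by rewrite C.
by rewrite !gK J.
Qed.

Lemma jordan_degenerates lam mu : jordan lam -> degenerates lam mu -> jordan mu.
Proof.
move=> jlam d; split=> x y.
  apply: (degenerates_identity (F := fun nu : algebra V => nu x y)
    (G := fun nu : algebra V => nu y x) _ _ _ d); first by solve_polymap.
    by solve_polymap.
  by move=> nu /jordan_stable/(_ jlam)[].
apply: (degenerates_identity
  (F := fun nu : algebra V => nu (nu x y) (nu x x))
  (G := fun nu : algebra V => nu x (nu y (nu x x))) _ _ _ d); first by solve_polymap.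
  by solve_polymap.
by move=> nu /jordan_stable/(_ jlam)[].
Qed.

Definition square_rank1 lam := forall f x y,
  f (lam x y) ^+ 2 = f (lam x x) * f (lam y y).

Definition collinear_products lam := forall f g x y z w,
  f (lam x y) * g (lam z w) = g (lam x y) * f (lam z w).

Definition product_nil lam := forall x y z, lam (lam x y) z = 0.

Lemma low_rank_degenerates lam mu : degenerates lam mu ->
  (forall nu, Orb lam nu -> low_rank nu) -> low_rank mu.
Proof.
move=> d h f x y fx fy; apply: subr0_eq.
apply: (degenerates_polyfun (F := fun nu : algebra V =>
  f (nu x y) ^+ 2 - f (nu x x) * f (nu y y)) _ _ d).
  by solve_polyfun.
by move=> nu /h h'; rewrite h' // subrr.
Qed.

Lemma square_rank1_degenerates lam mu : degenerates lam mu ->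
  (forall nu, Orb lam nu -> square_rank1 nu) -> square_rank1 mu.
Proof.
move=> d h f x y; apply: subr0_eq.
apply: (degenerates_polyfun (F := fun nu : algebra V =>
  f (nu x y) ^+ 2 - f (nu x x) * f (nu y y)) _ _ d).
  by solve_polyfun.
by move=> nu /h ->; rewrite subrr.
Qed.

Lemma collinear_products_degenerates lam mu : degenerates lam mu ->
  (forall nu, Orb lam nu -> collinear_products nu) -> collinear_products mu.
Proof.
move=> d h f g x y z w; apply: subr0_eq.
apply: (degenerates_polyfun (F := fun nu : algebra V =>
  f (nu x y) * g (nu z w) - g (nu x y) * f (nu z w)) _ _ d).
  by solve_polyfun.
by move=> nu /h h'; rewrite (h' f g) subrr.
Qed.

Lemma product_nil_degenerates lam mu : degenerates lam mu ->
  (forall nu, Orb lam nu -> product_nil nu) -> product_nil mu.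
Proof.
move=> d h x y z.
apply: (degenerates_identity (F := fun nu : algebra V => nu (nu x y) z)
  (G := fun=> 0) _ _ _ d); try by solve_polymap.
by move=> nu /h.
Qed.

Lemma kernel_vector f e : f e = 1 -> exists y, f y = 0 /\ free [:: e; y].
Proof.
move=> fe; have [z hz] := exists_notin_line e dV.
exists (z - f z *: e); split; first by rewrite !scalE fe mulr1 subrr.
apply: free2P => [|a E]; first exact: functional1_neq0 fe.
by apply: (hz (a + f z)); rewrite scalerDl -E subrK.
Qed.

(** The products e e = e and e y = a y are independent. *)
Lemma not_collinear_products lam e y a :
  free [:: e; y] -> a != 0 -> lam e e = e -> lam e y = a *: y ->
  ~ collinear_products lam.
Proof.
move=> fr a0 ee ey col.
have [f [fe fy]] := functional_values2 1 0 fr.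
have [g [ge gy]] := functional_values2 0 1 fr.
have := col f g e e e y; rewrite ee ey !scalE fe fy ge gy.
by rewrite !(mulr1, mul1r, mulr0, mul0r) => /eqP; rewrite (negPf a0).
Qed.

Lemma half_form_not_collinear lam : half_form lam -> ~ collinear_products lam.
Proof.
move=> [f [e [fe lamE]]]; have [y [fy fr]] := kernel_vector fe.
apply: (not_collinear_products (a := 2^-1) fr).
- by rewrite invr_eq0 pnatr_eq0.
- by rewrite lamE fe; apply: functional_ext => g; rewrite !(scalE g); field.
by rewrite lamE fe fy scale1r scale0r addr0.
Qed.

Lemma unit_form_not_collinear lam : unit_form lam -> ~ collinear_products lam.
Proof.
move=> [f [e [fe lamE]]]; have [y [fy fr]] := kernel_vector fe.
apply: (not_collinear_products (a := 1) fr).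
- exact: oner_neq0.
- rewrite lamE fe; apply: functional_ext => g; rewrite !(scalE g); ring.
by rewrite lamE fe fy mulr0 !scale0r subr0 addr0.
Qed.

Lemma idempotent_not_product_nil lam e :
  e != 0 -> lam e e = e -> ~ product_nil lam.
Proof. by move=> e0 ee h; case/eqP: e0; rewrite -(h e e e) !ee. Qed.

Lemma half_form_idempotent lam : half_form lam ->
  exists e, e != 0 /\ lam e e = e.
Proof.
move=> [f [e [fe lamE]]]; exists e; split; first exact: functional1_neq0 fe.
by rewrite lamE fe; apply: functional_ext => g; rewrite !(scalE g); field.
Qed.

Lemma idem_form_idempotent lam : idem_form lam ->
  exists e, e != 0 /\ lam e e = e.
Proof.
move=> [f [e [fe lamE]]]; exists e; split; first exact: functional1_neq0 fe.
by rewrite lamE fe mulr1 scale1r.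
Qed.

Lemma unit_form_idempotent lam : unit_form lam ->
  exists e, e != 0 /\ lam e e = e.
Proof.
move=> [f [e [fe lamE]]]; exists e; split; first exact: functional1_neq0 fe.
by rewrite lamE fe; apply: functional_ext => g; rewrite !(scalE g); ring.
Qed.

Lemma square_rank1_low_rank lam : square_rank1 lam -> low_rank lam.
Proof. by move=> h f x y _ _. Qed.

Lemma idem_form_degenerates lam mu : jordan lam -> idem_form lam ->
  degenerates lam mu -> mu != 0 -> null_form mu \/ idem_form mu.
Proof.
move=> jlam flam d mu0; have jmu := jordan_degenerates jlam d.
have sq : square_rank1 mu.
  apply: (square_rank1_degenerates d) => nu /idem_form_stable/(_ flam).
  move=> [f [e [_ nuE]]] g x y; rewrite !nuE !scalE; ring.
have col : collinear_products mu.
  apply: (collinear_products_degenerates d) => nu /idem_form_stable/(_ flam).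
  move=> [f [e [_ nuE]]] g h x y z w; rewrite !nuE !scalE; ring.
case: (low_rank_classification dV jmu (square_rank1_low_rank sq) mu0).
- by left.
- by move=> /half_form_not_collinear.
- by right.
by move=> /unit_form_not_collinear.
Qed.

Lemma null_form_degenerates lam mu : jordan lam -> null_form lam ->
  degenerates lam mu -> mu != 0 -> null_form mu.
Proof.
move=> jlam flam d mu0; have jmu := jordan_degenerates jlam d.
have sq : square_rank1 mu.
  apply: (square_rank1_degenerates d) => nu /null_form_stable/(_ flam).
  move=> [f [x' [c [_ _ _ nuE]]]] g x y; rewrite !nuE !scalE; ring.
have nil : product_nil mu.
  apply: (product_nil_degenerates d) => nu /null_form_stable/(_ flam).
  move=> [f [x' [c [_ fc _ nuE]]]] x y z; rewrite !nuE !scalE fc.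
  by rewrite mulr0 mul0r scale0r.
case: (low_rank_classification dV jmu (square_rank1_low_rank sq) mu0) => //.
- by move=> /half_form_idempotent[e [e0 /(idempotent_not_product_nil e0)]].
- by move=> /idem_form_idempotent[e [e0 /(idempotent_not_product_nil e0)]].
by move=> /unit_form_idempotent[e [e0 /(idempotent_not_product_nil e0)]].
Qed.

Lemma not_low_rank lam : ~ low_rank lam -> exists f x y,
  [/\ f x = 0, f y = 0 & f (lam x y) ^+ 2 <> f (lam x x) * f (lam y y)].
Proof.
move=> nlr; apply: NNPP => hn; apply: nlr => f x y fx fy.
by apply: NNPP => E; apply: hn; exists f, x, y.
Qed.

Definition minor3 lam f (x y z u v w : V) :=
  f (lam x u) * (f (lam y v) * f (lam z w) - f (lam y w) * f (lam z v))
  - f (lam x v) * (f (lam y u) * f (lam z w) - f (lam y w) * f (lam z u))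
  + f (lam x w) * (f (lam y u) * f (lam z v) - f (lam y v) * f (lam z u)).

(** Besides the vanishing of triple products and the collinearity of all products, the
form f(uv) has rank at most two. When the rank condition of the classification fails,
a hyperbolic pair x, y spans the form modulo its radical: the minor on (x, y, u) and
(x, y, v) expresses f(uv) by f(ux), f(uy), f(vx) and f(vy). *)
Lemma hyper_form_degenerates lam mu : jordan lam -> hyper_form lam ->
  degenerates lam mu -> mu != 0 -> null_form mu \/ hyper_form mu.
Proof.
move=> jlam flam d mu0; have jmu := jordan_degenerates jlam d.
have nil : product_nil mu.
  apply: (product_nil_degenerates d) => nu /hyper_form_stable/(_ flam).
  move=> [f [g [_ [_ [c [[[_ _ fc] [_ _ gc]] [_ nuE]]]]]]] x y z.
  by rewrite !nuE !scalE fc gc !mulr0 !mul0r addr0 scale0r.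
have col : collinear_products mu.
  apply: (collinear_products_degenerates d) => nu /hyper_form_stable/(_ flam).
  move=> [f [g [_ [_ [c [_ [_ nuE]]]]]]] k h x y z w.
  by rewrite !nuE !scalE; ring.
have minor f x y z u v w : minor3 mu f x y z u v w = 0.
  apply: (degenerates_polyfun (F := fun nu => minor3 nu f x y z u v w) _ _ d).
    by rewrite /minor3; solve_polyfun.
  move=> nu /hyper_form_stable/(_ flam) [h [g [_ [_ [c [_ [_ nuE]]]]]]].
  by rewrite /minor3 !nuE !scalE; ring.
have [lr|nlr] := classic (low_rank mu).
  case: (low_rank_classification dV jmu lr mu0); first by left.
  - by move=> /half_form_idempotent[e [e0 /(idempotent_not_product_nil e0)]].
  - by move=> /idem_form_idempotent[e [e0 /(idempotent_not_product_nil e0)]].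
  by move=> /unit_form_idempotent[e [e0 /(idempotent_not_product_nil e0)]].
right; have [f [x0 [y0 [fx0 fy0 hq]]]] := not_low_rank nlr.
have C : commutative_algebra mu by case: jmu.
have [x [y [fx fy fxx fyy fxy]]] := hyperbolic_pair C fx0 fy0 hq.
pose c := mu x y.
have prodE u v : mu u v = f (mu u v) *: c.
  apply: functional_ext => g; have := col f g u v x y.
  by rewrite fxy mulr1 scalE => <-.
have [a aE] : exists a : {scalar V}, forall v, a v = f (mu v y).
  by apply: functional_of => t u v; rewrite !algE !scalE.
have [b bE] : exists b : {scalar V}, forall v, b v = f (mu v x).
  by apply: functional_of => t u v; rewrite !algE !scalE.
exists a, b, x, y, c; split.
  by rewrite !aE !bE fxy fyy fxx (C y x) fxy /c !nil !scalar0.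
split=> [|u v].
  by apply/eqP => c0; move/eqP: fxy; rewrite -/c c0 scalar0 eq_sym oner_eq0.
rewrite prodE; congr (_ *: _); have := minor f x y u x y v.
rewrite /minor3 fxx fyy (C y x) fxy !aE !bE (C x v) (C y v) => E.
lincomb1 (-1) E.
Qed.

Lemma unit_form_low_rank lam : unit_form lam -> low_rank lam.
Proof.
move=> [h [e [he lamE]]] f x y fx fy.
by rewrite !lamE !(scalE f) fx fy; ring.
Qed.

(** The trace of multiplication by [x]. *)
Definition left_trace lam x :=
  \sum_(i < \dim {:V}) coord (vbasis {:V}) i (lam x (vbasis {:V})`_i).

Lemma sum_coord f x :
  \sum_(i < \dim {:V}) f (vbasis {:V})`_i * coord (vbasis {:V}) i x = f x.
Proof.
rewrite [in RHS](coord_vbasis (memvf x)) linear_sum; apply: eq_bigr => i _.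
by rewrite scalarM mulrC.
Qed.

(** Multiplication by [x] is [f x] plus a nilpotent map. *)
Lemma unit_form_trace lam f e : f e = 1 ->
  (forall u v, lam u v = f u *: v + f v *: u - (f u * f v) *: e) ->
  forall x, left_trace lam x = (\dim {:V})%:R * f x.
Proof.
move=> fe lamE x; rewrite /left_trace.
have E (i : 'I_(\dim {:V})) :
    coord (vbasis {:V}) i (lam x (vbasis {:V})`_i) =
    f x + (f (vbasis {:V})`_i * coord (vbasis {:V}) i x
      + - f x * (f (vbasis {:V})`_i * coord (vbasis {:V}) i e)).
  rewrite lamE !(scalE (coord (vbasis {:V}) i)).
  rewrite /= coord_free ?(basis_free (vbasisP _)) // eqxx mulr1.
  by ring.
rewrite (eq_bigr _ (fun i _ => E i)) !big_split -mulr_sumr !sum_coord /=.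
by rewrite sumr_const card_ord fe mulr1 subrr addr0 mulr_natl.
Qed.

Lemma idem_form_trace lam f e :
  (forall u v, lam u v = (f u * f v) *: e) ->
  forall x, left_trace lam x = f x * f e.
Proof.
move=> lamE x; rewrite /left_trace -[in RHS](sum_coord f e) mulr_sumr.
by apply: eq_bigr => i _; rewrite lamE linearZ mulrA.
Qed.

(** In J_2 the trace of multiplication satisfies tr(x)^2 = n tr(xx), whereas at the
idempotent of J_1 both traces are 1. *)
Lemma unit_form_not_idem lam mu : unit_form lam -> degenerates lam mu ->
  ~ idem_form mu.
Proof.
move=> flam d [f [e [fe muE]]].
have : left_trace mu e ^+ 2 - (\dim {:V})%:R * left_trace mu (mu e e) = 0.
  apply: (degenerates_polyfun (F := fun nu => left_trace nu e ^+ 2 -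
    (\dim {:V})%:R * left_trace nu (nu e e)) _ _ d).
    apply: polyfunB.
      apply: polyfunX; apply: polyfun_sum => i.
      by apply: (_ : polymap (fun nu : algebra V => nu e _)); solve_polymap.
    apply: polyfunM; first exact: polyfun_cst.
    apply: polyfun_sum => i.
    by apply: (_ : polymap (fun nu : algebra V => nu (nu e e) _)); solve_polymap.
  move=> nu /unit_form_stable/(_ flam)[h [a [ha nuE]]].
  rewrite !(unit_form_trace ha nuE) nuE.
  move: ((\dim {:V})%:R : K) => N.
  by rewrite !(scalE h) ha; ring.
rewrite muE fe mulr1 scale1r !(idem_form_trace muE) fe !mulr1 expr1n.
move=> /subr0_eq/eqP; rewrite eq_sym pnatr_eq1 => /eqP d1.
by move: dV; rewrite d1.
Qed.

Lemma operator_det (A : V -> V) : linear A ->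
  \det (\matrix_(i, j) coord (vbasis {:V}) j (A (vbasis {:V})`_i)) = 0 <->
  exists2 w, w != 0 & A w = 0.
Proof.
move=> Al; set b := vbasis {:V}; set M := \matrix_(i, j) _.
have mulM (v : 'rV_(\dim {:V})) j :
    (v *m M) 0 j = coord b j (A (\sum_(i < \dim {:V}) v 0 i *: b`_i)).
  rewrite (linear_map_sum _ _ Al) linear_sum mxE; apply: eq_bigr => i _.
  by rewrite mxE (linear_mapZ _ _ Al) linearZ.
have fb : free b := basis_free (vbasisP _).
split=> [/eqP/det0P[v v0 vM]|[w w0 Aw]].
  exists (\sum_(i < \dim {:V}) v 0 i *: b`_i).
    apply: contraNneq v0 => E; apply/eqP/rowP => i; rewrite mxE.
    by apply: (freeP fb (fun i => v 0 i)).
  rewrite [LHS](coord_vbasis (memvf _)) big1 // => j _.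
  by rewrite -mulM vM mxE scale0r.
have wE : w = \sum_(i < \dim {:V}) (\row_i coord b i w) 0 i *: b`_i.
  by rewrite [LHS](coord_vbasis (memvf w)); apply: eq_bigr => i _; rewrite mxE.
apply/eqP/det0P; exists (\row_i coord b i w).
  apply: contraNneq w0 => E; apply/eqP; rewrite wE E big1 // => i _.
  by rewrite mxE scale0r.
by apply/rowP => j; rewrite mulM -wE Aw linear0 mxE.
Qed.

(** With T = L_x^2 - L_{xx}, the hypothesis says that T + x f is injective, hence that the
kernel of T, which contains x and x x, is the line of x. Thus x x = a x. If a = 0, then
L_x^3 = 0 and every x (x z) vanishes, so that T = 0, which is absurd. Otherwise
e = x / a is an idempotent, and by the Peirce cubic 2 L_e - 1 takes its values in the
kernel of T. *)
Lemma half_form_of_rank lam x f : jordan lam -> f x = 1 ->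
  (forall v, lam x (lam x v) - lam (lam x x) v + f v *: x = 0 -> v = 0) ->
  half_form lam.
Proof.
move=> jlam fx inj; have mC : commutative_algebra lam by case: jlam.
have x0 := functional1_neq0 fx.
have ker v : lam x (lam x v) = lam (lam x x) v -> v = f v *: x.
  move=> E; apply: subr0_eq; apply: inj.
  by rewrite !algE E (mC (lam x x) x) subrr !scalE fx mulr1 subrr scale0r addr0.
pose a := f (lam x x).
have xx : lam x x = a *: x by apply: ker; rewrite jordan_pow4.
have [a0|a0] := eqVneq a 0.
  have xx0 : lam x x = 0 by rewrite xx a0 scale0r.
  have [z hz] := exists_notin_line x dV; case: (hz (f z)); apply: (ker).
  rewrite xx0 algE.
  have xxz : lam x (lam x (lam x z)) = 0.
    have := jordan_linearized jlam x x z; rewrite xx0 !algE scaler0 !add0r => E.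
    apply: (scalerI (_ : 2%:R != 0 :> K)); first by rewrite pnatr_eq0.
    by rewrite scaler0.
  have := ker (lam x z); rewrite xx0 xxz algE => /(_ erefl) ->.
  by rewrite algE xx0 scaler0.
have [e eD] : exists e, e = a^-1 *: x by eexists.
have xe : x = a *: e by rewrite eD scalerA mulfV // scale1r.
have ee : lam e e = e.
  by rewrite eD !algE xx scalerK ?unitfE.
have [p pE] : exists p : {scalar V}, forall y,
    p y = 2^-1 * a * f (2 *: lam e y - y).
  by apply: functional_of => t u v; rewrite !algE !scalE; ring.
have fe : f e = a^-1 by rewrite eD !scalE fx mulr1.
have fue y : 2 *: lam e y - y = f (2 *: lam e y - y) *: x.
  apply: ker; rewrite xx xe !algE.
  have := idempotent_cubic jlam y ee; move: (lam e (lam e (lam e y))) => u3.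
  move: (lam e (lam e y)) (lam e y) => u2 u1 E; apply: functional_ext => g.
  have := congr1 g E; rewrite !(scalE g) => E'.
  lincomb1 (a ^+ 2) E'.
apply: (half_form_of_idempotent jlam ee (p := p)).
  by rewrite pE ee !(scalE f) fe; field.
move=> y; have := fue y; rewrite xe => E; apply: functional_ext => g.
have := congr1 g E; rewrite pE !(scalE g) => E'.
lincomb1 2^-1 E'.
Qed.

(** The determinant of the operator of [half_form_of_rank] is a polynomial in the product,
non-zero at [mu], so it is non-zero somewhere on the orbit of [lam]. *)
Lemma half_form_open lam mu : jordan lam -> degenerates lam mu ->
  half_form mu -> half_form lam.
Proof.
move=> jlam d [f [e [fe muE]]]; apply: NNPP => hlam.
pose A nu v := nu e (nu e v) - nu (nu e e) v + f v *: e.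
have Al nu : linear (A nu).
  move=> t u v; rewrite /A !algE !(scalE f); apply: functional_ext => g.
  by rewrite !(scalE g); ring.
have : \det (\matrix_(i, j)
    coord (vbasis {:V}) j (A mu (vbasis {:V})`_i)) = 0.
  apply: (degenerates_polyfun (F := fun nu => \det (\matrix_(i, j)
    coord (vbasis {:V}) j (A nu (vbasis {:V})`_i))) _ _ d).
    apply: polyfun_det => i j.
    by apply: (_ : polymap (fun nu => A nu _)); rewrite /A; solve_polymap.
  move=> nu lamnu; apply: NNPP => nd; apply: hlam.
  apply: (half_form_stable (Orb_sym lamnu)).
  apply: (half_form_of_rank (jordan_stable lamnu jlam) fe) => v Av.
  apply/eqP/negPn/negP => v0; apply: nd.
  by apply/(operator_det (Al nu)); exists v.
move=> /(operator_det (Al mu))[w /eqP w0]; rewrite /A !muE fe !(scalE f) fe => E.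
have fw : f w = 0.
  have := congr1 f E; rewrite !(scalE f) fe => E'.
  lincomb1 1 E'.
apply: w0; apply: functional_ext => g; have := congr1 g E.
rewrite !(scalE g) fw => E'.
lincomb1 (-4) E'.
Qed.

Lemma unit_form_not_half lam : unit_form lam -> ~ half_form lam.
Proof.
move=> [f [e [fe lamE]]] [g [a [ga lamE']]].
have [y [fy fr]] := kernel_vector fe.
have [h [he hy]] := functional_values2 0 1 fr.
have [k [ke ky]] := functional_values2 1 0 fr.
have := lamE' (e + y) (e + y); rewrite lamE !(scalE f) fe fy => E.
move: (congr1 h E) (congr1 k E); rewrite !(scalE h) !(scalE k) he hy ke ky.
move: (g (e + y)) => t E1 E2.
suff : 1 = 0 :> K by apply/eqP; rewrite oner_eq0.
lincomb2 1 E1 (-1) E2.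
Qed.

Lemma unit_form_degenerates lam mu : jordan lam -> unit_form lam ->
  degenerates lam mu -> mu != 0 -> null_form mu \/ unit_form mu.
Proof.
move=> jlam flam d mu0; have jmu := jordan_degenerates jlam d.
have lr : low_rank mu.
  apply: (low_rank_degenerates d) => nu /unit_form_stable/(_ flam).
  exact: unit_form_low_rank.
case: (low_rank_classification dV jmu lr mu0).
- by left.
- by move=> /(half_form_open jlam d)/(unit_form_not_half flam).
- by move=> /(unit_form_not_idem flam d).
by right.
Qed.

End Closed.

(** * The tables of J_1, J_2 and J_3 *)

Section Tables.
Variables (K : fieldType) (V : vectType K) (n : nat) (e : n.-tuple V).
Hypothesis be : basis_of fullv e.

Lemma algebra_basis_ext (lam mu : algebra V) :
  (forall i j : 'I_n, lam e`_i e`_j = mu e`_i e`_j) -> lam = mu.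
Proof.
move=> E; apply: algebra_ext => x y.
rewrite (coord_basis be (memvf x)) !alg_suml; apply: eq_bigr => i _.
rewrite (coord_basis be (memvf y)) (linear_sum (lam _)) (linear_sum (mu _)).
by apply: eq_bigr => j _ /=; rewrite !algE E.
Qed.

Lemma coord_dual (i j : 'I_n) : coord e i e`_j = (j == i)%:R.
Proof. by rewrite coord_free // (basis_free be). Qed.

Lemma basis_neq0 (i : 'I_n) : e`_i != 0.
Proof.
by apply: (functional1_neq0 (f := coord e i)); rewrite /= coord_dual eqxx.
Qed.

Lemma J1_idem_form : (0 < n)%N -> idem_form (J1 e).
Proof.
move=> n0; pose i0 := Ordinal n0; exists (coord e i0), e`_i0; split.
  by apply: (etrans (coord_dual i0 i0)); rewrite eqxx.
pose m u v := (coord e i0 u * coord e i0 v) *: e`_i0.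
have mE : forall u v, bilinear_algebra m u v = m u v.
  apply: bilinear_algebraE => w a u v; rewrite /m;
    apply: functional_ext => h; rewrite !scalE; ring.
suff -> : J1 e = bilinear_algebra m by exact: mE.
apply: algebra_basis_ext => i j; rewrite table_algebraE // mE /m !coord_dual.
case: i => [[|i] hi]; case: j => [[|j] hj] /=;
  by rewrite ?(mulr1, mulr0, mul0r) ?scale1r ?scale0r.
Qed.

Lemma J2_unit_form : (0 < n)%N -> unit_form (J2 e).
Proof.
move=> n0; pose i0 := Ordinal n0; exists (coord e i0), e`_i0; split.
  by apply: (etrans (coord_dual i0 i0)); rewrite eqxx.
pose m u v := coord e i0 u *: v + coord e i0 v *: u
  - (coord e i0 u * coord e i0 v) *: e`_i0.
have mE : forall u v, bilinear_algebra m u v = m u v.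
  apply: bilinear_algebraE => w a u v; rewrite /m;
    apply: functional_ext => h; rewrite !scalE; ring.
suff -> : J2 e = bilinear_algebra m by exact: mE.
apply: algebra_basis_ext => i j; rewrite table_algebraE // mE /m !coord_dual.
case: i => [[|i] hi]; case: j => [[|j] hj] /=;
  by rewrite ?(mulr1, mulr0, mul0r) ?scale1r ?scale0r ?subr0 ?addr0 ?add0r ?addrK.
Qed.

Lemma J3_hyper_form : (2 < n)%N -> hyper_form (J3 e).
Proof.
move=> n2; have n1 := ltnW n2; have n0 := ltnW n1.
pose i0 := Ordinal n0; pose i1 := Ordinal n1; pose i2 := Ordinal n2.
exists (coord e i0), (coord e i1), e`_i0, e`_i1, e`_i2.
split; first by split; split; apply: (etrans (coord_dual _ _)).
split; first exact: basis_neq0.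
pose m u v := (coord e i0 u * coord e i1 v + coord e i1 u * coord e i0 v) *: e`_i2.
have mE : forall u v, bilinear_algebra m u v = m u v.
  apply: bilinear_algebraE => w a u v; rewrite /m;
    apply: functional_ext => h; rewrite !scalE; ring.
suff -> : J3 e = bilinear_algebra m by exact: mE.
apply: algebra_basis_ext => i j; rewrite table_algebraE // mE /m !coord_dual.
case: i => [[|[|i]] hi]; case: j => [[|[|j]] hj] /=;
  by rewrite ?(mulr1, mulr0, mul0r, addr0, add0r) ?scale1r ?scale0r.
Qed.

End Tables.

(** * Algebras of level two *)

Section Levels.
Variables (K : numClosedFieldType) (V : vectType K).
Hypothesis dV : (2 < \dim {:V})%N.
Implicit Types (lam mu nu : algebra V).

Let two0 : 2%:R != 0 :> K. Proof. by rewrite pnatr_eq0. Qed.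

Lemma null_form_neq0 lam : null_form lam -> lam != 0.
Proof.
move=> [f [x [c [fx _ c0 lamE]]]]; apply: contraNneq c0 => lam0.
by have := lamE x x; rewrite lam0 !zero_lfunE fx mulr1 scale1r => <-.
Qed.

Lemma null_form_square_rank1 lam : null_form lam -> square_rank1 lam.
Proof.
by move=> [f [x' [c [_ _ _ lamE]]]] g x y; rewrite !lamE !scalE; ring.
Qed.

Lemma null_form_product_nil lam : null_form lam -> product_nil lam.
Proof.
move=> [f [x' [c [_ fc _ lamE]]]] x y z.
by rewrite !lamE !scalE fc mulr0 mul0r scale0r.
Qed.

Lemma null_form_not_idempotent lam e : null_form lam -> e != 0 -> lam e e <> e.
Proof.
by move=> /null_form_product_nil h e0 ee; apply: idempotent_not_product_nil e0 ee h.
Qed.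

Lemma hyper_form_not_square_rank1 lam : hyper_form lam -> ~ square_rank1 lam.
Proof.
move=> [f [g [x [y [c [[[fx fy _] [gx gy _]] [c0 lamE]]]]]]] sq.
have [h hc] := functional_values1 1 c0.
have := sq h x y; rewrite !lamE !scalE fx fy gx gy hc => E.
by move/eqP: (oner_neq0 K); apply; lincomb1 1 E.
Qed.

Definition level2_form lam := [\/ idem_form lam, unit_form lam | hyper_form lam].

Lemma level2_form_not_null lam : level2_form lam -> ~ null_form lam.
Proof.
case=> flam nlam.
- have [e [e0 ee]] := idem_form_idempotent flam.
  exact: null_form_not_idempotent nlam e0 ee.
- have [e [e0 ee]] := unit_form_idempotent flam.
  exact: null_form_not_idempotent nlam e0 ee.
exact: hyper_form_not_square_rank1 flam (null_form_square_rank1 nlam).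
Qed.

Lemma level2_form_stable lam mu : Orb lam mu -> level2_form lam -> level2_form mu.
Proof.
move=> o [] f; [apply: Or31|apply: Or32|apply: Or33].
- exact: idem_form_stable o f.
- exact: unit_form_stable o f.
exact: hyper_form_stable o f.
Qed.

Lemma level2_form_degenerates lam mu : jordan lam -> level2_form lam ->
  degenerates lam mu -> mu <> 0 -> null_form mu \/ Orb lam mu.
Proof.
move=> jlam flam d /eqP mu0; case: flam => f.
- have [|f'] := idem_form_degenerates dV jlam f d mu0; first by left.
  by right; apply: idem_form_Orb.
- have [|f'] := unit_form_degenerates dV jlam f d mu0; first by left.
  by right; apply: unit_form_Orb.
have [|f'] := hyper_form_degenerates dV jlam f d mu0; first by left.
by right; apply: hyper_form_Orb.
Qed.

Lemma square_not_collinear lam x (f : {scalar V}) : f x = 0 -> f (lam x x) != 0 ->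
  forall a, lam x x <> a *: x.
Proof. by move=> fx fxx a E; case/eqP: fxx; rewrite E scalarM fx mulr0. Qed.

Lemma level2_form_null lam : level2_form lam ->
  exists mu, null_form mu /\ degenerates lam mu.
Proof.
case=> [[f [e [fe lamE]]]|[f [e [fe lamE]]]|].
- have [y [fy fr]] := kernel_vector dV fe.
  have [g [ge gy]] := functional_values2 1 (-1) fr.
  apply: (@degenerates_null_form _ _ _ (e + y)).
  apply: (square_not_collinear (f := g)); first by rewrite scalE ge gy subrr.
  by rewrite lamE !scalE fe fy ge addr0 !mulr1 oner_neq0.
- have [y [fy fr]] := kernel_vector dV fe.
  have [g [ge gy]] := functional_values2 1 (-1) fr.
  apply: (@degenerates_null_form _ _ _ (e + y)).
  apply: (square_not_collinear (f := g)); first by rewrite scalE ge gy subrr.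
  rewrite lamE !scalE fe fy ge gy.
  rewrite [X in X != 0](_ : _ = -1); first by rewrite oppr_eq0 oner_neq0.
  by ring.
move=> [f [g [x [y [c [[[fx fy fc] [gx gy gc]] [c0 lamE]]]]]]].
apply: (@degenerates_null_form _ _ _ (x + y)) => a E.
have a0 : a = 0.
  have := congr1 f E; rewrite lamE !scalE fx fy fc mulr0 addr0 mulr1.
  by move=> <-.
have [h hc] := functional_values1 1 c0.
have := congr1 h E; rewrite lamE a0 scale0r !scalE fx fy gx gy hc => E'.
by case/eqP: two0; lincomb1 1 E'.
Qed.

Lemma degenerates_from_zero mu : degenerates (0 : algebra V) mu -> mu = 0.
Proof.
move=> d; apply: algebra_ext => x y; rewrite !zero_lfunE.
apply: (degenerates_identity (F := fun nu : algebra V => nu x y)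
  (G := fun=> 0) _ _ _ d); try by solve_polymap.
move=> nu /OrbP[g [h [gl _ _ _ ->]]].
by rewrite !zero_lfunE linear_map0.
Qed.

Lemma degenerates_to_zero lam : degenerates lam 0.
Proof.
have [z hz] := exists_notin_line (0 : V) dV.
have z0 : z != 0 by apply/eqP => z0; apply: (hz 0); rewrite z0 scaler0.
have [f fz] := functional_values1 1 z0.
exact: degenerates_zero fz.
Qed.

Lemma nontrivial_to_zero lam : lam <> 0 -> nontrivial_degeneration lam 0.
Proof.
move=> lam0; split; first exact: degenerates_to_zero.
by move=> /Orb_sym/degenerates_Orb/degenerates_from_zero.
Qed.

Lemma nontrivial_source_neq0 lam mu : nontrivial_degeneration lam mu -> lam <> 0.
Proof.
move=> [d ni] lam0; apply: ni; move: d; rewrite lam0.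
by move=> /degenerates_from_zero ->; apply: Orb_refl.
Qed.

Lemma null_form_nontrivial lam mu : jordan lam -> null_form lam ->
  nontrivial_degeneration lam mu -> mu = 0.
Proof.
move=> jlam flam [d ni]; apply/eqP/negPn/negP => mu0; apply: ni.
exact: null_form_Orb flam (null_form_degenerates dV jlam flam d mu0).
Qed.

Lemma level2_form_nontrivial lam mu : jordan lam -> level2_form lam ->
  nontrivial_degeneration lam mu -> null_form mu \/ mu = 0.
Proof.
move=> jlam flam [d ni]; have [|mu0] := classic (mu = 0); first by right.
by have [|o] := level2_form_degenerates jlam flam d mu0; first by left.
Qed.

(** The only non-zero algebra strictly below is [null_form], which lies directly above 0. *)
Lemma level2_form_has_level lam : jordan lam -> level2_form lam -> has_level lam 2.
Proof.
move=> jlam flam; split.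
  have [mu [fmu d]] := level2_form_null flam.
  have jmu := jordan_degenerates jlam d.
  have mu0 : mu <> 0 by apply/eqP; apply: null_form_neq0.
  apply: (@direct_chainS _ _ 1 lam mu); last first.
    apply: (@direct_chainS _ _ 0 mu 0); last exact: direct_chain0.
    split; first exact: nontrivial_to_zero.
    move=> [nu [n1 n2]]; apply: (nontrivial_source_neq0 n2).
    exact: null_form_nontrivial jmu fmu n1.
  split.
    split=> // o; apply: (level2_form_not_null flam).
    exact: null_form_stable (Orb_sym o) fmu.
  move=> [nu [n1 n2]]; have nu0 := nontrivial_source_neq0 n2.
  have [fnu|//] := level2_form_nontrivial jlam flam n1.
  by case: n2 => _; apply; apply: null_form_Orb.
have lvl0 l mu nu : direct_chain l mu nu -> mu = 0 -> l = 0%N.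
  by case=> // k mu' nu' rho [/nontrivial_source_neq0 mu0 _] _ /mu0.
have lvl1 l mu nu : direct_chain l mu nu -> jordan mu -> null_form mu -> (l <= 1)%N.
  case=> // k mu' nu' rho [n1 _] ch jmu' fmu'.
  by rewrite (lvl0 _ _ _ ch) //; apply: null_form_nontrivial n1.
have lvl2 l mu nu : direct_chain l mu nu -> jordan mu -> level2_form mu -> (l <= 2)%N.
  case=> // k mu' nu' rho [n1 _] ch jmu' fmu'.
  have [f|z] := level2_form_nontrivial jmu' fmu' n1.
    by apply: (lvl1 _ _ _ ch) => //; case: n1 => d _; apply: jordan_degenerates d.
  by rewrite (lvl0 _ _ _ ch).
by move=> l ch; apply: lvl2 ch jlam flam.
Qed.

(** An element whose square is not a multiple of it exists in J_1, J_2 and J_3, and every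
Jordan algebra without [half_form] reaches one of these or is already [null_form]. *)
Lemma jordan_null lam : jordan lam -> lam <> 0 -> ~ half_form lam ->
  exists mu, null_form mu /\ degenerates lam mu.
Proof.
move=> jlam /eqP lam0 hlam.
have [lr|nlr] := classic (low_rank lam).
  case: (low_rank_classification dV jlam lr lam0) => //.
  - by move=> f; exists lam; split=> //; apply: degenerates_Orb; apply: Orb_refl.
  - by move=> f; apply: level2_form_null; apply: Or31.
  by move=> f; apply: level2_form_null; apply: Or32.
have [f [x [y [fx fy hq]]]] := not_low_rank nlr.
have C : commutative_algebra lam by case: jlam.
have [mu [fmu d]] := degenerates_hyper_form C fx fy hq.
have [nu [fnu d']] := level2_form_null (Or33 _ _ fmu).
by exists nu; split=> //; apply: degenerates_trans d d'.
Qed.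

(** In [half_form] every square is a multiple of its argument, a closed condition. *)
Lemma half_form_not_null lam mu : half_form lam -> degenerates lam mu ->
  ~ null_form mu.
Proof.
move=> flam d [f [x [c [fx fc c0 muE]]]].
have mux : mu x x = c by rewrite muE fx mulr1 scale1r.
have fr : free [:: x; c].
  apply: free2P => [|a E]; first exact: functional1_neq0 fx.
  have := congr1 f E; rewrite fc scalarM fx mulr1 => a0.
  by case/eqP: c0; rewrite E -a0 scale0r.
have [g [gx gc]] := functional_values2 1 0 fr.
have [h [hx hc]] := functional_values2 0 1 fr.
have : g x * h (mu x x) - h x * g (mu x x) = 0.
  apply: (degenerates_polyfun (F := fun nu : algebra V =>
    g x * h (nu x x) - h x * g (nu x x)) _ _ d).
    apply: polyfunB; apply: polyfunM; try exact: polyfun_cst.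
      by apply: (_ : polymap (fun nu : algebra V => nu x x)); solve_polymap.
    by apply: (_ : polymap (fun nu : algebra V => nu x x)); solve_polymap.
  move=> nu /half_form_stable/(_ flam)[k [e [_ nuE]]].
  by rewrite !nuE !scalE; ring.
rewrite mux gx gc hx hc mulr0 subr0 mulr1 => /eqP.
by rewrite oner_eq0.
Qed.

(** A chain of two direct degenerations lam -> mu -> 0 passes through a [mu] of
[null_form]; if [lam] violates the rank condition, the J_3 to which it degenerates lies
between [lam] and [mu]. *)
Lemma has_level2_form lam : jordan lam -> has_level lam 2 -> level2_form lam.
Proof.
move=> jlam [ch _].
have [mu [[n1 dir1] [n2 dir2]]] : exists mu,
    direct_degeneration lam mu /\ direct_degeneration mu 0.
  inversion ch as [|k l1 mu l3 d1 ch1]; subst.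
  inversion ch1 as [|k l4 nu l6 d2 ch2]; subst.
  inversion ch2; subst.
  by exists mu.
have jmu := jordan_degenerates jlam (proj1 n1).
have mu0 := nontrivial_source_neq0 n2; have lam0 := nontrivial_source_neq0 n1.
have hmu : ~ half_form mu.
  move=> fmu; have flam := half_form_open dV jlam (proj1 n1) fmu.
  by case: n1 => _; apply; apply: half_form_Orb.
have [nu [fnu dnu]] := jordan_null jmu mu0 hmu.
have fmu : null_form mu.
  have [o|no] := classic (Orb mu nu); first exact: null_form_stable (Orb_sym o) fnu.
  case: dir2; exists nu; split; first by split.
  by apply: nontrivial_to_zero; apply/eqP; apply: null_form_neq0.
have [lr|nlr] := classic (low_rank lam).
  case: (low_rank_classification dV jlam lr (introN eqP lam0)).
  - by move=> flam; case: n1 => _ []; apply: null_form_Orb.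
  - by move=> flam; case: (half_form_not_null flam (proj1 n1) fmu).
  - by move=> f; apply: Or31.
  by move=> f; apply: Or32.
have [f [x [y [fx fy hq]]]] := not_low_rank nlr.
have C : commutative_algebra lam by case: jlam.
have [rho [frho drho]] := degenerates_hyper_form C fx fy hq.
have [o|no] := classic (Orb lam rho).
  by apply: Or33; apply: hyper_form_stable (Orb_sym o) frho.
case: dir1; exists rho; split; first by split.
have [sig [fsig dsig]] := level2_form_null (Or33 _ _ frho).
split; last first.
  move=> o; apply: (level2_form_not_null (Or33 _ _ frho)).
  exact: null_form_stable (Orb_sym o) fmu.
by apply: degenerates_trans dsig _; apply: degenerates_Orb; apply: null_form_Orb.
Qed.

End Levels.

Theorem theorem3p1 (R : realType) (n : nat) (hn : (3 <= n)%N)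
    (V : vectType (complex R)) (e : n.-tuple V) (he : basis_of fullv e)
    (lam : algebra V) (hlam : jordan lam) :
  has_level lam 2 <->
  (isomorphic lam (J1 e) \/ isomorphic lam (J2 e) \/ isomorphic lam (J3 e)).
Proof.
have dV : (2 < \dim {:V})%N by rewrite (vector.size_basis he).
have f1 : idem_form (J1 e) by apply: J1_idem_form => //; apply: leq_trans hn.
have f2 : unit_form (J2 e) by apply: J2_unit_form => //; apply: leq_trans hn.
have f3 : hyper_form (J3 e) by apply: J3_hyper_form.
split=> [/(has_level2_form dV hlam)[f|f|f]|iso].
- by left; apply: idem_form_Orb.
- by right; left; apply: unit_form_Orb.
- by right; right; apply: hyper_form_Orb.
apply: (level2_form_has_level dV hlam).
case: iso => [|[]] /Orb_sym o.
- exact: level2_form_stable o (Or31 _ _ f1).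
- exact: level2_form_stable o (Or32 _ _ f2).
exact: level2_form_stable o (Or33 _ _ f3).
Qed.
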